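(* The polygon $P^2$ has the least area among all right-angled polygons (of finite area, with finitely many sides) in $H^2$.
   Context: Use the hyperboloid model $H^2=\{x\in\mathbb{R}^3: x_1^2+x_2^2-x_3^2=-1,\ x_3>0\}$. $P^2$ is the triangle $\{x\in H^2: x_1\ge0,\ x_2\ge0,\ x_1+x_2\le x_3\}$, which has one actual vertex $e_3$ with angle $\pi/2$ and two ideal vertices (represented by $e_1+e_3$ and $e_2+e_3$); its area is $\pi/2$. A polygon is right-angled if all its angles are $0$ or $\pi/2$. *)

(* Defs.v *)
From HB Require Import structures.
From mathcomp Require Import all_boot all_order all_algebra.
From mathcomp Require Import all_classical all_reals all_analysis.
Set Implicit Arguments. Unset Strict Implicit. Unset Printing Implicit Defensive.
Import Order.TTheory GRing.Theory Num.Theory.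
Local Open Scope classical_set_scope.
Local Open Scope ring_scope.

Section Hyperbolic.
Variable R : realType.

Definition pt := (R * R * R)%type.
Definition x1 (x : pt) : R := x.1.1.
Definition x2 (x : pt) : R := x.1.2.
Definition x3 (x : pt) : R := x.2.

Definition mink (x y : pt) : R := x1 x * x1 y + x2 x * x2 y - x3 x * x3 y.

Definition H2 : set pt := [set x | mink x x = -1 /\ 0 < x3 x].

Definition hlift (p : R * R) : pt :=
  (p.1, p.2, Num.sqrt (1 + p.1 ^+ 2 + p.2 ^+ 2)).

(* hyperbolic area of S ⊆ H^2: in the chart (x1, x2) the induced Riemannian
   area element is dx1 dx2 / sqrt(1 + x1^2 + x2^2). *)
Definition harea (S : set pt) : \bar R :=
  (\int[(@lebesgue_measure R \x @lebesgue_measure R)%E]_(p in [set p | S (hlift p)])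
     ((Num.sqrt (1 + p.1 ^+ 2 + p.2 ^+ 2))^-1)%:E)%E.

Definition hpoly (n : nat) (e : 'I_n -> pt) : set pt :=
  [set x | H2 x /\ forall i, mink x (e i) <= 0].

Definition hside (n : nat) (e : 'I_n -> pt) (i : 'I_n) : set pt :=
  [set x | hpoly e x /\ mink x (e i) = 0].

(* S is a (convex, nondegenerate) polygon with finitely many sides, whose
   sides are given by the half-planes e i (spacelike normals), each of which
   is a genuine side (contains more than one point), and which is
   right-angled: any two distinct sides meeting at a point of H^2 (a finite
   vertex) are orthogonal, i.e. the angle there is pi/2.  (Sides meeting only
   at an ideal point make angle 0 automatically.) *)
Definition right_angled_polygon (S : set pt) : Prop :=
  exists (n : nat) (e : 'I_n -> pt),
    [/\ S = hpoly e,
        forall i, 0 < mink (e i) (e i),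
        exists x, H2 x /\ forall i, mink x (e i) < 0,
        forall i, exists x y, [/\ hside e i x, hside e i y & x <> y]
      & forall i j, i <> j -> (hside e i `&` hside e j) !=set0 ->
          mink (e i) (e j) = 0].

Definition P2 : set pt :=
  [set x | H2 x /\ [/\ 0 <= x1 x, 0 <= x2 x & x1 x + x2 x <= x3 x]].

End Hyperbolic.

(* Main.v *)
(** Gauss-Bonnet, done by slicing. In the coordinates
    [x = (sqrt (1+s^2) t, s, sqrt (1+s^2) sqrt (1+t^2))] the area element is
    [dt ds / sqrt (1+t^2)] and the lines [t = constant] are geodesics (those
    perpendicular to [x2 = 0]). Over an interval of values of [t] where the
    same side bounds the polygon from above and the same side from below, the
    length of the slices integrates explicitly: a primitive is the difference
    of the angles at which the two sides cross the slicing geodesics. At a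
    vertex, at an ideal vertex, and where the polygon begins or ends, these
    angles jump by multiples of [pi/2], because all angles are [0] or [pi/2].
    Summing over the intervals, the area is at least a positive number that is
    congruent to [0] modulo [pi/2], hence at least [pi/2]; and the same
    primitive shows that [P2] has area at most [pi/2]. *)
Require Import Defs.
From HB Require Import structures.
From mathcomp Require Import all_boot all_order all_algebra.
From mathcomp Require Import all_classical all_reals all_analysis.
From mathcomp Require Import measurable_realfun.
From mathcomp Require Import ring lra.
Import Order.TTheory GRing.Theory Num.Theory.
Import numFieldNormedType.Exports.
Local Open Scope classical_set_scope.
Local Open Scope ring_scope.

(** The multiples of [pi/2] are never computed and the sides are never put in cyclic order. Each
    interval of slices yields a lower bound for its area together with the class of that bound
    modulo [pi/2], and a function [angle] of the slice alone makes these classes telescope. A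
    congruence says nothing about size, so strict positivity comes from one interval that starts at
    a slice through the interior. The polygon may extend to infinity in both directions of [t],
    where the angles only tend to [0]; the outer ends are therefore chosen last, so far out that
    their error is below both the tolerance and the positive amount already secured. Slices of
    infinite length also occur: there the bound can be chosen freely within its class. *)

(** * Area as an integral over slices *)

Section slicing.
Context {R : realType}.
Local Notation mu := (@lebesgue_measure R).
Implicit Types (t s : R) (S : set (pt R)).

Definition hypot t : R := Num.sqrt (1 + t ^+ 2).

Lemma hypot_gt0 t : 0 < hypot t.
Proof. by rewrite sqrtr_gt0; have := sqr_ge0 t; lra. Qed.

Lemma sqr_hypot t : hypot t ^+ 2 = 1 + t ^+ 2.
Proof. by rewrite sqr_sqrtr//; have := sqr_ge0 t; lra. Qed.

(** With [t = sinh u] and [s = sinh v] this is [(cosh v sinh u, sinh v, cosh v cosh u)]: [v] is the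
    signed distance to the line [x2 = 0], and [u] is the position of the foot on it. *)
Definition cyl t s : pt R := (hypot s * t, s, hypot s * hypot t).

Lemma hlift_cyl t s : hlift (hypot s * t, s) = cyl t s.
Proof.
rewrite /hlift /cyl /=; congr (_, _).
rewrite -[RHS](@ger0_norm _ (hypot s * hypot t)); last first.
  by rewrite mulr_ge0// ltW// hypot_gt0.
by rewrite -sqrtr_sqr; congr Num.sqrt; rewrite !exprMn !sqr_hypot; ring.
Qed.

Lemma continuous_hypot : continuous hypot.
Proof.
move=> t; apply: continuous_comp; last exact: sqrt_continuous.
apply: cvgD; first exact: cvg_cst.
exact: exprn_continuous.
Qed.

Lemma measurable_hypot : measurable_fun setT hypot.
Proof. exact: (continuous_measurable_fun continuous_hypot). Qed.

Lemma measurable_scale (k : R) :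
  measurable_fun [set: measurableTypeR R] ( *%R k : _ -> measurableTypeR R).
Proof. exact: measurable_funM. Qed.

(** By uniqueness of Lebesgue measure: the rescaled pushforward agrees with it on half-open
    intervals. *)
Lemma lebesgue_measure_scale (k : R) (X : set R) : 0 < k -> measurable X ->
  (k%:E * mu ( *%R k @^-1` X) = mu X)%E.
Proof.
move=> k0 mX; pose K := NngNum (ltW k0).
pose pf : {measure set (measurableTypeR R) -> \bar R} :=
  measure_function_pushforward__canonical__measure_function_Measure
    mu (measurable_scale k).
transitivity (mscale K pf X) => //.
apply/esym/lebesgue_measure_unique => //= _ [[a b]] _ <-.
rewrite /mscale /= /pushforward.
rewrite [X in (_ = _ * lebesgue_measure X)%E](_ : _ = `]a / k, b / k]%classic); last first.
  apply/seteqP; split => x /=; rewrite !in_itv/= ltr_pdivrMr// ler_pdivlMr//;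
    by rewrite mulrC.
rewrite !lebesgue_measure_itv/= !lte_fin ltr_pM2r ?invr_gt0//.
case: ifPn => _; last by rewrite mule0.
by rewrite -!EFinB -EFinM -mulrBl mulrC divfK// gt_eqF.
Qed.

Lemma ge0_integral_scale (k : R) (f : R -> \bar R) : 0 < k ->
  measurable_fun setT f -> (forall x, 0 <= f x)%E ->
  (\int[mu]_x f x = k%:E * \int[mu]_x f (k * x)%R)%E.
Proof.
move=> k0 mf f0.
pose K := NngNum (ltW k0).
pose pf : {measure set (measurableTypeR R) -> \bar R} :=
  measure_function_pushforward__canonical__measure_function_Measure
    mu (measurable_scale k).
rewrite (eq_measure_integral (mscale K pf)); last first.
  by move=> A mA _; rewrite /mscale /= -(lebesgue_measure_scale k A).
rewrite ge0_integral_mscale//=; congr (_ * _)%E.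
by rewrite ge0_integral_pushforward.
Qed.

(** For fixed [s] the substitution [x1 = hypot s * t] is a scaling; its factor [hypot s] cancels in
    the density, because [sqrt (1 + x1^2 + x2^2) = hypot s * hypot t]. Tonelli is applied once to
    integrate over [x1] first, and once more to bring [t] outside. *)
Lemma harea_slices S : measurable [set p : R * R | S (hlift p)] ->
  measurable_fun setT (fun t => ((hypot t)^-1%:E * mu [set s | S (cyl t s)])%E) /\
  harea S = (\int[mu]_t ((hypot t)^-1%:E * mu [set s | S (cyl t s)]))%E.
Proof.
move=> mS; rewrite /harea integral_mkcond.
set E := [set p | S (hlift p)].
pose f (p : R * R) : \bar R := ((\1_E p) * (Num.sqrt (1 + p.1 ^+ 2 + p.2 ^+ 2))^-1)%:E.
have m1 : measurable_fun [set: measurableTypeR R * measurableTypeR R]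
  (fst : _ -> R) by exact: measurable_fst.
have m2 : measurable_fun [set: measurableTypeR R * measurableTypeR R]
  (snd : _ -> R) by exact: measurable_snd.
have msqrt : measurable_fun [set: R] (@Num.sqrt R).
  by apply: continuous_measurable_fun; exact: sqrt_continuous.
have mV : measurable_fun [set: R] (fun t => (hypot t)^-1).
  apply: continuous_measurable_fun => t; apply: cvgV.
    by rewrite gt_eqF// hypot_gt0.
  exact: continuous_hypot.
have f0 p : (0 <= f p)%E by rewrite lee_fin mulr_ge0// invr_ge0 sqrtr_ge0.
have mf : measurable_fun setT f.
  apply/measurable_EFinP; apply: measurable_funM; first exact: measurable_indic.
  rewrite (_ : (fun _ => _) =
    fun p : R * R => (hypot (Num.sqrt (p.1 ^+ 2 + p.2 ^+ 2)))^-1); last first.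
    by apply/funext => p; rewrite /hypot sqr_sqrtr ?addr_ge0 ?sqr_ge0// addrA.
  apply: (measurableT_comp mV); apply: (measurableT_comp msqrt).
  by apply: measurable_funD; exact: measurable_funX.
rewrite (_ : _ \_ _ = f); last first.
  apply/funext => p; rewrite patchE /f indicE.
  by case: (p \in E); rewrite /= ?mul1r ?mul0r.
pose phi (p : R * R) := (hypot p.2 * p.1, p.2).
have mphi : measurable_fun [set: measurableTypeR R * measurableTypeR R]
    (phi : _ -> measurableTypeR R * measurableTypeR R)%type.
  apply/measurable_fun_pair => //=; apply: measurable_funM => //.
  exact: (measurableT_comp measurable_hypot).
pose h (p : R * R) : \bar R := (\1_(phi @^-1` E) p * (hypot p.1)^-1)%:E.
have h0 p : (0 <= h p)%E by rewrite lee_fin mulr_ge0// invr_ge0 sqrtr_ge0.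
have mphiE : measurable (phi @^-1` E : set (measurableTypeR R * measurableTypeR R)).
  by rewrite -[X in measurable X]setTI; exact: mphi.
have mh : measurable_fun setT h.
  apply/measurable_EFinP; apply: measurable_funM.
    exact: measurable_indic.
  exact: (measurableT_comp mV).
have hE : fubini_F mu h = (fun t => (hypot t)^-1%:E * mu [set s | S (cyl t s)])%E.
  apply/funext => t; rewrite /fubini_F.
  have ES : [set s | S (cyl t s)] = xsection (phi @^-1` E) t.
    by apply/seteqP; split => s /=; rewrite /xsection/= inE /E/= hlift_cyl.
  rewrite ES.
  have mx : measurable (xsection (phi @^-1` E) t : set (measurableTypeR R)).
    exact: measurable_xsection.
  transitivity (\int[mu]_s ((hypot t)^-1%:E *
      (\1_(xsection (phi @^-1` E) t) s)%:E))%E.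
    by apply: eq_integral => s _; rewrite /h -EFinM mulrC !indicE mem_xsection.
  rewrite ge0_integralZl//=.
  - by rewrite integral_indic// setIT.
  - by apply/measurable_EFinP; exact: measurable_indic.
  - by rewrite lee_fin invr_ge0 sqrtr_ge0.
split.
  by rewrite -hE; exact: measurable_fun_fubini_tonelli_F.
rewrite fubini_tonelli2//.
transitivity (\int[mu]_s (fubini_G mu h s))%E.
  apply: eq_integral => s _; rewrite /fubini_G.
  have mfs : measurable_fun [set: R] (fun t => f (t, s)).
    exact: (measurableT_comp mf).
  rewrite (ge0_integral_scale (hypot s) (fun t => f (t, s))) ?hypot_gt0//.
  rewrite -ge0_integralZl//=.
  - apply: eq_integral => t _; rewrite /f /h -EFinM; congr EFin.
    rewrite [hypot s * (_ * _)]mulrCA; congr (_ * _) => /=.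
    rewrite (_ : Num.sqrt _ = (cyl t s).2); last by rewrite -hlift_cyl.
    by rewrite /= invfM mulVKf ?gt_eqF ?hypot_gt0.
  - by apply: (measurableT_comp mfs); exact: measurable_scale.
  - by rewrite lee_fin sqrtr_ge0.
rewrite -fubini_tonelli2// fubini_tonelli1//; apply: eq_integral => t _.
by rewrite -[RHS]/((fun t => _) t) -hE.
Qed.
End slicing.

(** * A continuous extension of the arcsine *)

Section clipped_asin.
Context {R : realType}.
Implicit Types x y : R.

(* [asin] has junk values outside [[-1, 1]]; clipping its argument makes it
   continuous on the whole line. *)
Definition clip x : R := (`|x + 1| - `|x - 1|) / 2.

Lemma clip_itv x : -1 <= clip x <= 1.
Proof. by rewrite /clip; case: (ger0P (x + 1)); case: (ger0P (x - 1)); lra. Qed.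

Lemma clip_id x : -1 <= x <= 1 -> clip x = x.
Proof. by rewrite /clip; case: (ger0P (x + 1)); case: (ger0P (x - 1)); lra. Qed.

Lemma continuous_clip : continuous clip.
Proof.
move=> x; apply: cvgM; last exact: cvg_cst.
by apply: cvgB; apply: cvg_norm; apply: cvgD;
  [exact: cvg_id|exact: cvg_cst|exact: cvg_id|exact: cvg_cst].
Qed.

Lemma within_continuous_asin : {within `[(-1), 1], continuous (@asin R)}.
Proof.
have := @segment_can_le_continuous R (- (pi / 2)) (pi / 2) sin asin.
rewrite sinN sin_pihalf; apply.
- by have := pi_gt0 R; lra.
- exact/continuous_subspaceT/continuous_sin.
- exact: sinK.
Qed.

Definition casin x : R := asin (clip x).

Lemma casinE x : -1 <= x <= 1 -> casin x = asin x.
Proof. by move=> x1; rewrite /casin clip_id. Qed.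

Lemma continuous_casin : continuous casin.
Proof.
move=> x; rewrite /casin.
have cx : `[(-1), 1]%classic (clip x) by rewrite /= in_itv/= clip_itv.
have := within_continuous_asin (clip x).
move=> h; have {}h : asin y @[y --> within `[(-1), 1]%classic (nbhs (clip x))] --> asin (clip x).
  by rewrite nbhs_subspace_in.
apply: cvg_comp h => P /= HP.
have : \forall z \near x, `[(-1), 1]%classic (clip z) -> P (clip z).
  exact: (@continuous_clip x _ HP).
by apply: filterS => z; apply; rewrite /= in_itv/= clip_itv.
Qed.

Lemma is_derive_casin x : -1 < x < 1 ->
  is_derive x (1 : R) casin (Num.sqrt (1 - x ^+ 2))^-1.
Proof.
move=> x1; have := is_derive1_asin x1; apply: near_eq_is_derive.
have : x \in `](-1), 1[ by rewrite in_itv/=.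
move=> /near_in_itvoo; apply: filterS => y; rewrite in_itv/= => /andP[y1 y2].
by rewrite casinE// !ltW.
Qed.

Lemma casin_itv x : - (pi / 2) <= casin x <= pi / 2.
Proof. by rewrite asin_geNpi2 ?clip_itv// asin_lepi2 ?clip_itv. Qed.

End clipped_asin.

(** * The angle function of a single side *)

Section side.
Context {R : realType}.
Implicit Types A C t : R.

Lemma is_derive_hypot t : is_derive t (1 : R) hypot (t / hypot t).
Proof.
have t0 : 0 < 1 + t ^+ 2 by have := sqr_ge0 t; lra.
have ? : is_derive (1 + t ^+ 2) (1 : R) Num.sqrt (2 * Num.sqrt (1 + t ^+ 2))^-1.
  exact: is_derive1_sqrt.
rewrite /hypot.
have -> : t / Num.sqrt (1 + t ^+ 2) = (2 * Num.sqrt (1 + t ^+ 2))^-1 * (t *+ 2).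
  have := hypot_gt0 t; rewrite /hypot => /lt0r_neq0 r0.
  by field.
have ? : is_derive t (1 : R) (fun t => 1 + t ^+ 2) (t *+ 2).
  by apply: is_derive_eq; rewrite add0r mul1r /GRing.scale/= mulr1 mulr2n.
exact: (@is_derive1_comp _ Num.sqrt (fun t => 1 + t ^+ 2)).
Qed.

(* The geodesic [A x1 + x2 = C x3] meets the slice of parameter [t] at the point
   with [s / sqrt (1+s^2) = slope A C t]. *)
Definition slope A C t : R := C * hypot t - A * t.

(* The signed angle between this geodesic and the curves orthogonal to the slices; its
   cosine and sine are computed in [cos_ang] and [sin_ang]. *)
Definition ang A C t : R :=
  casin ((C * t - A * hypot t) / Num.sqrt (1 + A ^+ 2 - C ^+ 2)).

Lemma continuous_slope A C : continuous (slope A C).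
Proof.
move=> t; apply: cvgB; apply: cvgM; try exact: cvg_cst; try exact: cvg_id.
exact: continuous_hypot.
Qed.

Lemma continuous_ang A C : continuous (ang A C).
Proof.
move=> t; apply: continuous_comp; last exact: continuous_casin.
apply: cvgM; last exact: cvg_cst.
apply: cvgB; apply: cvgM; try exact: cvg_cst; try exact: cvg_id.
exact: continuous_hypot.
Qed.

(** Since [hypot t ^ 2 - t ^ 2 = 1], the map from [(C, A)] to [(C hypot t - A t, C t - A hypot t)]
    is a hyperbolic rotation (up to sign) and preserves [C^2 - A^2]. *)
Lemma slope_sqr A C t :
  1 + A ^+ 2 - C ^+ 2 - (C * t - A * hypot t) ^+ 2 = 1 - slope A C t ^+ 2.
Proof. by have := sqr_hypot t; rewrite /slope => h; nra. Qed.

Lemma ang_arg A C t : 0 < 1 + A ^+ 2 - C ^+ 2 ->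
  1 - ((C * t - A * hypot t) / Num.sqrt (1 + A ^+ 2 - C ^+ 2)) ^+ 2 =
  (1 - slope A C t ^+ 2) / (1 + A ^+ 2 - C ^+ 2).
Proof.
move=> K0; rewrite -slope_sqr expr_div_n sqr_sqrtr ?ltW//.
by field; rewrite gt_eqF.
Qed.

Lemma sin_ang A C t : 0 < 1 + A ^+ 2 - C ^+ 2 -> -1 <= slope A C t <= 1 ->
  sin (ang A C t) = (C * t - A * hypot t) / Num.sqrt (1 + A ^+ 2 - C ^+ 2).
Proof.
move=> K0 w1; have := ang_arg _ _ t K0; set x := _ / Num.sqrt _ => xE.
have x1 : -1 <= x <= 1.
  have : 0 <= 1 - x ^+ 2.
    by rewrite xE mulr_ge0 ?invr_ge0 ?(ltW K0)//; nra.
  nra.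
by rewrite /ang casinE// asinK.
Qed.

Lemma cos_ang A C t : 0 < 1 + A ^+ 2 - C ^+ 2 -> -1 <= slope A C t <= 1 ->
  cos (ang A C t) = Num.sqrt (1 - slope A C t ^+ 2) / Num.sqrt (1 + A ^+ 2 - C ^+ 2).
Proof.
move=> K0 w1; have := ang_arg _ _ t K0; set x := _ / Num.sqrt _ => xE.
have x1 : -1 <= x <= 1.
  have : 0 <= 1 - x ^+ 2.
    by rewrite xE mulr_ge0 ?invr_ge0 ?(ltW K0)//; nra.
  nra.
have w0 : 0 <= 1 - slope A C t ^+ 2 by nra.
by rewrite /ang casinE// cos_asin// xE sqrtrM// sqrtrV// ltW.
Qed.

(** The derivative is the signed length in [s] of the slice between [x2 = 0] and the side, divided
    by [hypot t]: exactly the integrand of the area. This is why angles measure area. *)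
Lemma is_derive_ang A C t : 0 < 1 + A ^+ 2 - C ^+ 2 -> -1 < slope A C t < 1 ->
  is_derive t (1 : R) (ang A C)
    (slope A C t / Num.sqrt (1 - slope A C t ^+ 2) / hypot t).
Proof.
move=> K0 w1; have := ang_arg _ _ t K0; set x := _ / Num.sqrt _ => xE.
have w0 : 0 < 1 - slope A C t ^+ 2 by nra.
have x1 : -1 < x < 1.
  have : 0 < 1 - x ^+ 2 by rewrite xE mulr_gt0 ?invr_gt0.
  nra.
have K1 : Num.sqrt (1 + A ^+ 2 - C ^+ 2) != 0 by rewrite gt_eqF ?sqrtr_gt0.
have w2 : Num.sqrt (1 - slope A C t ^+ 2) != 0 by rewrite gt_eqF ?sqrtr_gt0.
have r0 := lt0r_neq0 (hypot_gt0 t).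
have ? := is_derive_casin x x1.
have ? := is_derive_hypot t.
pose g t := (C * t - A * hypot t) / Num.sqrt (1 + A ^+ 2 - C ^+ 2).
have ? : is_derive t (1 : R) g
    ((C - A * (t / hypot t)) / Num.sqrt (1 + A ^+ 2 - C ^+ 2)).
  rewrite /g; apply: is_derive_eq; rewrite /GRing.scale/=.
  by field; apply/andP.
have -> : slope A C t / Num.sqrt (1 - slope A C t ^+ 2) / hypot t =
   (Num.sqrt (1 - x ^+ 2))^-1 *
   ((C - A * (t / hypot t)) / Num.sqrt (1 + A ^+ 2 - C ^+ 2)).
  rewrite xE sqrtrM ?sqrtrV ?ltW// /slope; field.
  by rewrite -/(slope A C t); apply/and3P.
exact: (@is_derive1_comp _ casin g).
Qed.

End side.

(** * Congruence modulo [pi/2] *)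

Section mod_pihalf.
Context {R : realType}.
Implicit Types x y z : R.

Definition eqpih x y := exists k : int, x - y = k%:~R * (pi / 2).

Lemma eqpih_refl x : eqpih x x.
Proof. by exists 0; rewrite subrr mul0r. Qed.

Lemma eqpihB x y x' y' : eqpih x y -> eqpih x' y' -> eqpih (x - x') (y - y').
Proof.
by move=> [k kE] [l lE]; exists (k - l); rewrite mulrzBr mulrBl -kE -lE; ring.
Qed.

Lemma eqpihD x y x' y' : eqpih x y -> eqpih x' y' -> eqpih (x + x') (y + y').
Proof.
by move=> [k kE] [l lE]; exists (k + l); rewrite mulrzDr mulrDl -kE -lE; ring.
Qed.

Lemma cos_eq0_eqpih x : - pi <= x <= pi -> cos x = 0 -> eqpih x 0.
Proof.
have := pi_gt0 R => pi0 /andP[xN xP] cx.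
have [x1|x1|x1] := ltgtP x (pi / 2); last by exists 1; rewrite subr0 mul1r.
- have [x2|x2|x2] := ltgtP x (- (pi / 2)); last first.
  + by exists (-1); rewrite subr0 mulN1r.
  + by have := @cos_gt0_pihalf R x; rewrite cx x1 x2 ltxx => /(_ isT).
  + have := @cos_gt0_pihalf R (x + pi); rewrite cosDpi cx oppr0 ltxx => h.
    by have : false by apply: h; apply/andP; lra.
- have := @cos_gt0_pihalf R (x - pi).
  rewrite cosB cospi sinpi cx mul0r mulr0 addr0 ltxx => h.
  by have : false by apply: h; apply/andP; lra.
Qed.

End mod_pihalf.

(** * Angles at vertices, at ideal points and at infinity *)

Section side_angles.
Context {R : realType}.
Implicit Types A C t : R.

(** The side and the slice share an ideal end here, and [1 - slope^2] is the numerator of the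
    squared cosine. *)
Lemma ang_ideal A C t : 0 < 1 + A ^+ 2 - C ^+ 2 -> slope A C t ^+ 2 = 1 ->
  eqpih (ang A C t) 0.
Proof.
move=> K0 w1; apply: cos_eq0_eqpih.
  have := casin_itv ((C * t - A * hypot t) / Num.sqrt (1 + A ^+ 2 - C ^+ 2)).
  by rewrite -/(ang A C t); have := pi_gt0 R => ? /andP[? ?]; apply/andP; lra.
rewrite cos_ang// ?w1 ?subrr ?sqrtr0 ?mul0r//.
by apply/andP; split; nra.
Qed.

(** The cosine of the difference of the two angles is, up to normalisation, the Minkowski product
    [1 + A A' - C C'] of the normals. *)
Lemma ang_orthogonal A C A' C' t :
  0 < 1 + A ^+ 2 - C ^+ 2 -> 0 < 1 + A' ^+ 2 - C' ^+ 2 ->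
  slope A C t = slope A' C' t -> -1 < slope A C t < 1 ->
  1 + A * A' - C * C' = 0 -> eqpih (ang A C t) (ang A' C' t).
Proof.
move=> K0 K'0 ww w1 orth.
suff [k kE] : eqpih (ang A C t - ang A' C' t) 0 by exists k; rewrite -kE subr0.
apply: cos_eq0_eqpih.
  have := casin_itv ((C * t - A * hypot t) / Num.sqrt (1 + A ^+ 2 - C ^+ 2)).
  have := casin_itv ((C' * t - A' * hypot t) / Num.sqrt (1 + A' ^+ 2 - C' ^+ 2)).
  rewrite -/(ang A C t) -/(ang A' C' t).
  by have := pi_gt0 R => ? /andP[? ?] /andP[? ?]; apply/andP; lra.
have w1' : -1 <= slope A C t <= 1 by case/andP: w1 => ? ?; rewrite !ltW.
rewrite cosB !sin_ang// -?ww// !cos_ang// -?ww//.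
have K1 : Num.sqrt (1 + A ^+ 2 - C ^+ 2) != 0 by rewrite gt_eqF ?sqrtr_gt0.
have K1' : Num.sqrt (1 + A' ^+ 2 - C' ^+ 2) != 0 by rewrite gt_eqF ?sqrtr_gt0.
have w0 : 0 <= 1 - slope A C t ^+ 2 by nra.
rewrite mulf_div -expr2 sqr_sqrtr// mulf_div -mulrDl.
suff -> : 1 - slope A C t ^+ 2 + (C * t - A * hypot t) * (C' * t - A' * hypot t) = 0.
  by rewrite mul0r.
rewrite expr2 {2}ww /slope.
have : hypot t ^+ 2 = 1 + t ^+ 2 := sqr_hypot t.
move: (hypot t) => r rE.
have -> : 1 - (C * r - A * t) * (C' * r - A' * t) +
   (C * t - A * r) * (C' * t - A' * r) =
   (1 + A * A' - C * C') + (A * A' - C * C') * (r ^+ 2 - 1 - t ^+ 2) by ring.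
by rewrite orth rE; ring.
Qed.

Lemma casin0 : casin 0 = 0 :> R.
Proof.
rewrite casinE; last by apply/andP; lra.
by rewrite -[X in asin X]sin0 sinK// in_itv/=; have := pi_gt0 R; lra.
Qed.

Lemma ang_perp A C t : C * t = A * hypot t -> ang A C t = 0.
Proof. by move=> e; rewrite /ang e subrr mul0r casin0. Qed.

Lemma angN A C t : ang A C (- t) = ang A (- C) t.
Proof. by rewrite /ang /hypot sqrrN mulrN sqrrN mulNr. Qed.

Lemma slopeN A C t : slope A C (- t) = - slope A (- C) t.
Proof. by rewrite /slope /hypot sqrrN; ring. Qed.

Lemma hypot_sub_gt0 t : 0 < t -> 0 < hypot t - t <= t^-1.
Proof.
move=> t0; have r0 := hypot_gt0 t; have r2 := sqr_hypot t.
have rt : t < hypot t by nra.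
rewrite subr_gt0 rt/= -(ler_pM2r t0) mulVf ?gt_eqF//; nra.
Qed.

(** If [C <> A] the slope is unbounded and leaves []-1, 1[] for good. If [C = A] the normalising
    factor is [1] and the argument [A (t - hypot t)] of the arcsine tends to [0]. *)
Lemma ang_pinfty A C (e : R) : 0 < e -> exists M, forall t, M <= t ->
  -1 < slope A C t < 1 -> `|ang A C t| < e.
Proof.
move=> e0; have [->|CA] := eqVneq C A; last first.
  (* Beyond this bound [|C - A| t] exceeds [1 + |C|], while the remaining term [C (hypot t - t)] of
     the slope is at most [|C|] in absolute value. *)
  exists ((1 + `|C|) / `|C - A| + 1) => t tM /andP[w1 w2]; exfalso.
  have d0 : 0 < `|C - A| by rewrite normr_gt0 subr_eq0.
  have q0 : 0 <= (1 + `|C|) / `|C - A| by rewrite divr_ge0// addr_ge0.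
  have t1 : 1 <= t by lra.
  have t0 : 0 < t by lra.
  have /andP[h1 h2] := hypot_sub_gt0 t t0.
  have h3 : t^-1 <= 1 by rewrite invf_le1.
  have h4 : `|C * (hypot t - t)| <= `|C|.
    rewrite normrM ler_piMr// ger0_norm; lra.
  have h5 : 1 + `|C| < `|(C - A) * t|.
    rewrite normrM [`|t|]ger0_norm ?ltW// mulrC -ltr_pdivrMr//; lra.
  have h6 : slope A C t = (C - A) * t + C * (hypot t - t) by rewrite /slope; ring.
  have : `|slope A C t| < 1 by rewrite ltr_norml w1.
  have := lerB_normD ((C - A) * t) (C * (hypot t - t)).
  rewrite -h6; lra.
have := @continuous_casin R 0.
move=> /cvgrPdist_lt /(_ e e0) /nbhs_ballP[d d0 hd].
exists ((`|A| + 1) / d + 1) => t tM _.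
have q0 : 0 < (`|A| + 1) / d by rewrite divr_gt0// ltr_wpDl.
have t0 : 0 < t by lra.
have := hd ((A * t - A * hypot t) / Num.sqrt (1 + A ^+ 2 - A ^+ 2)).
rewrite -/(ang A A t) casin0 sub0r normrN; apply.
rewrite /ball/= sub0r normrN addrK sqrtr1 divr1 -mulrBr normrM.
have /andP[h1 h2] := hypot_sub_gt0 t t0.
rewrite distrC [`|hypot t - t|]ger0_norm ?ltW//.
have h3 : (`|A| + 1) * t^-1 < d.
  by rewrite ltr_pdivrMr// mulrC -ltr_pdivrMr//; lra.
apply: le_lt_trans h3; apply: ler_pM => //; lra.
Qed.

Lemma ang_ninfty A C (e : R) : 0 < e -> exists M, forall t, t <= - M ->
  -1 < slope A C t < 1 -> `|ang A C t| < e.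
Proof.
move=> e0; have [M HM] := ang_pinfty A (- C) e e0.
exists M => t tM; rewrite -[t]opprK slopeN angN => /andP[w1 w2].
by apply: HM; [lra | apply/andP; lra].
Qed.

End side_angles.

(** * Finitely many sign changes *)

Section sign.
Context {R : realType}.

Lemma poly_roots_seq (F : idomainType) (p : {poly F}) : p != 0 ->
  exists s : seq F, forall x, root p x -> x \in s.
Proof.
have [n] := ubnP (size p); elim: n p => // n IH p pn p0.
have [[x rx]|nr] := pselect (exists x, root p x); last first.
  by exists [::] => x rx; exfalso; apply: nr; exists x.
have /factor_theorem[q pq] := rx.
have q0 : q != 0 by apply: contra_neq p0 => q0; rewrite pq q0 mul0r.
have [|s hs] := IH q _ q0.
  by move: pn; rewrite pq size_mul ?polyXsubC_eq0// size_XsubC addn2 ltnS.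
exists (x :: s) => y; rewrite pq rootM root_XsubC in_cons => /orP[/hs ->|->//].
by rewrite orbT.
Qed.

(* The zeros of [slope A C t - B] are roots of a polynomial of degree 2. *)
Lemma slope_sign (A C B : R) : exists s : seq R, forall p q,
  (forall x, x \in s -> ~~ (p < x < q)) ->
  forall t t', p < t < q -> p < t' < q ->
  (0 < slope A C t - B -> 0 < slope A C t' - B) /\
  (slope A C t - B < 0 -> slope A C t' - B < 0).
Proof.
(* Obtained by squaring [C hypot t = A t + B]. Roots introduced by the squaring only add break
   points. *)
pose P : {poly R} := Poly [:: C ^+ 2 - B ^+ 2; - (2 * A * B); C ^+ 2 - A ^+ 2].
have PE t : slope A C t - B = 0 -> root P t.
  move=> e; rewrite /root /P horner_Poly /=.
  have := sqr_hypot t; move: e; rewrite /slope; move: (hypot t) => r e re.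
  have e1 : C * r = A * t + B by lra.
  have e2 : C ^+ 2 * r ^+ 2 = (A * t + B) ^+ 2 by rewrite -exprMn e1.
  rewrite re in e2; apply/eqP; nra.
(* A zero polynomial forces [A = B = C = 0]; the function is then identically zero and both
   implications are vacuous. *)
have [P0|P0] := eqVneq P 0.
  have coefE i : [:: C ^+ 2 - B ^+ 2; - (2 * A * B); C ^+ 2 - A ^+ 2]`_i = 0.
    by rewrite -coef_Poly -/P P0 coef0.
  have := coefE 0%N; have := coefE 1%N; have := coefE 2%N => /= c2 c1 c0.
  have [A0 C0 B0] : [/\ A = 0, C = 0 & B = 0].
    have AB : A * B = 0 by lra.
    have [A0|B0] : A = 0 \/ B = 0.
      by move/eqP: AB; rewrite mulf_eq0 => /orP[/eqP|/eqP]; [left|right].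
    + have C0 : C = 0 by apply/eqP; rewrite -sqrf_eq0; apply/eqP; rewrite A0 in c2; lra.
      by split=> //; apply/eqP; rewrite -sqrf_eq0; apply/eqP; rewrite C0 in c0; lra.
    + have C0 : C = 0 by apply/eqP; rewrite -sqrf_eq0; apply/eqP; rewrite B0 in c0; lra.
      by split=> //; apply/eqP; rewrite -sqrf_eq0; apply/eqP; rewrite C0 in c2; lra.
  by exists [::] => p q _ t t' _ _; rewrite /slope A0 B0 C0; split; lra.
have [s hs] := poly_roots_seq _ P P0.
exists s => p q hpq.
have nz t : p < t < q -> slope A C t - B != 0.
  by move=> tpq; apply/eqP => /PE/hs/hpq; rewrite tpq.
have key t t' : p < t < q -> p < t' < q ->
    0 < slope A C t - B -> slope A C t' - B < 0 -> False.
  have cf : continuous (fun t => slope A C t - B).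
    by move=> u; apply: cvgB; [exact: continuous_slope | exact: cvg_cst].
  move=> tpq t'pq f0 f'0.
  have [c cI fc] : exists2 c, p < c < q & slope A C c - B = 0.
    have [tt'|tt'] := leP t t'.
      have [||c cI cE] := @IVT R (fun t => slope A C t - B) t t' 0 tt'.
      - exact: continuous_subspaceT.
      - by rewrite ge_min le_max (ltW f0) (ltW f'0) !orbT.
      - exists c => //; move: cI; rewrite in_itv/=; lra.
    have [||c cI cE] := @IVT R (fun t => slope A C t - B) t' t 0 (ltW tt').
    - exact: continuous_subspaceT.
    - by rewrite ge_min le_max (ltW f0) (ltW f'0) !orbT.
    - exists c => //; move: cI; rewrite in_itv/=; lra.
  by have := nz _ cI; rewrite fc eqxx.
move=> t t' tpq t'pq; split => h.
  by have := nz _ t'pq; case: ltgtP => // h' _; have := key t t' tpq t'pq h h'.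
by have := nz _ t'pq; case: ltgtP => // h' _; have := key t' t t'pq tpq h' h.
Qed.

End sign.

(** * Integrals bounded below by an antiderivative *)

Section antiderivative.
Context {R : realType}.
Local Notation mu := (@lebesgue_measure R).
Implicit Types (G h : R -> R) (g : R -> \bar R) (a b p q : R).

Lemma integral_antiderivative G h a b : a < b ->
  (forall t, a <= t <= b -> is_derive t (1 : R) G (h t)) ->
  (forall t, a <= t <= b -> {for t, continuous h}) ->
  (\int[mu]_(t in `[a, b]) (h t)%:E = (G b - G a)%:E)%E.
Proof.
move=> ab dG ch.
have cG t : a <= t <= b -> {for t, continuous G}.
  move=> tab; apply: differentiable_continuous; apply/derivable1_diffP.
  exact: (@ex_derive _ _ _ _ _ _ _ (dG t tab)).
rewrite (@continuous_FTC2 _ h G) //.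
- apply: continuous_in_subspaceT => t; rewrite inE/= in_itv/= => tab.
  exact: ch.
- split.
  + move=> t; rewrite in_itv/= => /andP[ta tb].
    by apply: (@ex_derive _ _ _ _ _ _ _ (dG t _)); rewrite !ltW.
  + by apply: cvg_at_right_filter; apply: cG; rewrite lexx ltW.
  + by apply: cvg_at_left_filter; apply: cG; rewrite lexx ltW.
- move=> t; rewrite in_itv/= => /andP[ta tb].
  rewrite derive1E; apply: derive_val.
  by apply: dG; rewrite !ltW.
Qed.

Lemma antiderivative_lt G h p q : p < q -> continuous G ->
  (forall t, p < t < q -> is_derive t (1 : R) G (h t)) ->
  (forall t, p < t < q -> 0 < h t) -> G p < G q.
Proof.
move=> pq cG dG h0.
have dG' t : t \in `]p, q[ -> is_derive t (1 : R) G (h t).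
  by rewrite in_itv/= => tpq; exact: dG.
have [c] := MVT pq dG' (continuous_subspaceT cG).
by rewrite in_itv/= => cpq; rewrite -subr_gt0 => ->; rewrite mulr_gt0 ?h0// subr_gt0.
Qed.

(** [h] may blow up at [p] and [q], where a side can run to an ideal point. The fundamental theorem
    is therefore applied on an inner segment, and the continuity of [G] keeps the loss at each end
    below [e / 2]. *)
Lemma integral_ge_antiderivative G h g p q : p < q ->
  measurable_fun setT g -> (forall t, 0 <= g t)%E -> continuous G ->
  (forall t, p < t < q -> is_derive t (1 : R) G (h t)) ->
  (forall t, p < t < q -> {for t, continuous h}) ->
  (forall t, p < t < q -> 0 < h t) ->
  (forall t, p < t < q -> ((h t)%:E <= g t)%E) ->
  ((G q - G p)%:E <= \int[mu]_(t in `]p, q[) g t)%E.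
Proof.
move=> pq mg g0 cG dG ch h0 hg.
apply/lee_subgt0Pr => e e0; rewrite -EFinB.
have e2 : 0 < e / 2 by rewrite divr_gt0.
have [a [pa aq Ga]] : exists a, [/\ p < a, a < (p + q) / 2 & G a < G p + e / 2].
  have pm : p < (p + q) / 2 by lra.
  have : \forall a \near p^'+, G a < G p + e / 2.
    have := cvg_at_right_filter (cG p).
    move=> /cvgrPdist_lt /(_ _ e2); apply: filterS => a.
    by rewrite ltr_norml; lra.
  move=> H; near p^'+ => a; exists a; split; last by near: a.
  - by near: a; exact: nbhs_right_gt.
  - by near: a; exact: nbhs_right_lt.
have [b [pb bq Gb]] : exists b, [/\ (p + q) / 2 < b, b < q & G q - e / 2 < G b].
  have pm : (p + q) / 2 < q by lra.
  have : \forall a \near q^'-, G q - e / 2 < G a.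
    have := cvg_at_left_filter (cG q).
    move=> /cvgrPdist_lt /(_ _ e2); apply: filterS => b.
    by rewrite ltr_norml; lra.
  move=> H; near q^'- => b; exists b; split; last by near: b.
  - by near: b; exact: nbhs_left_gt.
  - by near: b; exact: nbhs_left_lt.
have ab : a < b by lra.
apply: (@le_trans _ _ (\int[mu]_(t in `[a, b]) (h t)%:E)%E).
  have dG' t : a <= t <= b -> is_derive t (1 : R) G (h t).
    by move=> /andP[? ?]; apply: dG; apply/andP; lra.
  rewrite (integral_antiderivative G h a b ab dG'); first by rewrite lee_fin; lra.
  by move=> t /andP[? ?]; apply: ch; apply/andP; lra.
apply: (@le_trans _ _ (\int[mu]_(t in `[a, b]) g t)%E).
  apply: ge0_le_integral => //.
  - move=> t /=; rewrite in_itv/= => /andP[? ?].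
    by rewrite lee_fin ltW// h0//; apply/andP; lra.
  - apply/measurable_EFinP; apply: subspace_continuous_measurable_fun => //.
    apply: continuous_in_subspaceT => t; rewrite inE/= in_itv/= => /andP[? ?].
    by apply: ch; apply/andP; lra.
  - exact: measurable_funS mg.
  - move=> t /=; rewrite in_itv/= => /andP[? ?].
    by apply: hg; apply/andP; lra.
apply: ge0_subset_integral => //; first exact: measurable_funS mg.
by move=> t /=; rewrite !in_itv/= => /andP[? ?]; apply/andP; lra.
Unshelve. all: by end_near. Qed.

End antiderivative.

(** * The slice coordinate [s / hypot s] *)

Section tau.
Context {R : realType}.
Implicit Types s w x y : R.

(** For [s = sinh v] the quotient [s / hypot s] is [tanh v]; [sigma] is the inverse of this passage
    on []-1, 1[]. *)
Definition sigma w : R := w / Num.sqrt (1 - w ^+ 2).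

Lemma hypot_sigma w : -1 < w < 1 -> hypot (sigma w) = (Num.sqrt (1 - w ^+ 2))^-1.
Proof.
move=> w1; have w0 : 0 < 1 - w ^+ 2 by nra.
rewrite /hypot /sigma expr_div_n sqr_sqrtr ?ltW// -sqrtrV ?ltW//.
by congr Num.sqrt; field; rewrite gt_eqF.
Qed.

Lemma sigmaK w : -1 < w < 1 -> sigma w / hypot (sigma w) = w.
Proof.
move=> w1; have w0 : 0 < 1 - w ^+ 2 by nra.
by rewrite hypot_sigma// invrK divfK// gt_eqF// sqrtr_gt0.
Qed.

Lemma ltr_tau : {mono (fun s => s / hypot s) : x y / x < y}.
Proof.
apply: leW_mono; apply: le_mono => x y xy.
have x0 := hypot_gt0 x; have y0 := hypot_gt0 y.
rewrite ltr_pdivrMr// mulrAC ltr_pdivlMr//.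
have x2 := sqr_hypot x; have y2 := sqr_hypot y.
have [x1|x1] := leP 0 x.
  have y1 : 0 <= y by lra.
  rewrite -(@ltr_pXn2r _ 2) ?nnegrE ?mulr_ge0 ?(ltW x0) ?(ltW y0)//.
  rewrite !exprMn x2 y2; nra.
have [y1|y1] := leP 0 y.
  have : 0 <= y * hypot x by rewrite mulr_ge0// ltW.
  have : 0 < (- x) * hypot y.
    by rewrite mulr_gt0 ?oppr_gt0.
  lra.
rewrite -ltrN2 -!mulNr.
rewrite -(@ltr_pXn2r _ 2) ?nnegrE ?mulr_ge0 ?oppr_ge0 ?(ltW x0) ?(ltW y0) ?(ltW x1) ?(ltW y1)//.
rewrite !exprMn !sqrrN x2 y2; nra.
Qed.

Lemma tau_ltr1 s : -1 < s / hypot s < 1.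
Proof.
have s0 := hypot_gt0 s; have s2 := sqr_hypot s.
by rewrite ltr_pdivlMr// ltr_pdivrMr//; apply/andP; split; nra.
Qed.

Lemma ler_tau x y : (x / hypot x <= y / hypot y) = (x <= y).
Proof. by rewrite !leNgt ltr_tau. Qed.

Lemma tau_le s w : -1 < w < 1 -> (s / hypot s <= w) = (s <= sigma w).
Proof. by move=> w1; rewrite -{1}(sigmaK w)// ler_tau. Qed.

Lemma tau_ge s w : -1 < w < 1 -> (w <= s / hypot s) = (sigma w <= s).
Proof. by move=> w1; rewrite -{1}(sigmaK w)// ler_tau. Qed.

Lemma sigma_lt w x : -1 < w < 1 -> -1 < x < 1 -> (sigma w < sigma x) = (w < x).
Proof. by move=> w1 x1; rewrite -ltr_tau !sigmaK. Qed.

End tau.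

(** * Upper and lower boundary of a polygon and their angles *)

Section polygon.
Context {R : realType} {n : nat} (e : 'I_n -> pt R).
Local Notation mu := (@lebesgue_measure R).
Implicit Types (i j k : 'I_n) (t s w : R).

(* [level] is used for the sides with [x2 (e i) = 0], which lie along a slice;
   the other sides are graphs over the [t]-axis ([graph] is a junk value if
   [x2 (e i) = 0]). *)
Definition level i t : R := slope (x1 (e i)) (x3 (e i)) t.

Definition graph i t : R := slope (x1 (e i) / x2 (e i)) (x3 (e i) / x2 (e i)) t.

Definition theta i t : R := ang (x1 (e i) / x2 (e i)) (x3 (e i) / x2 (e i)) t.

Lemma levelE i t : x2 (e i) != 0 -> level i t = x2 (e i) * graph i t.
Proof. by move=> b0; rewrite /level /graph /slope; field. Qed.

Lemma continuous_level i : continuous (level i).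
Proof. exact: continuous_slope. Qed.

Lemma continuous_graph i : continuous (graph i).
Proof. exact: continuous_slope. Qed.

Lemma continuous_theta i : continuous (theta i).
Proof. exact: continuous_ang. Qed.

(** The factor [hypot s] is positive, so every side condition becomes linear in [w = s / hypot s],
    and a slice is cut out of []-1, 1[] by half-lines. *)
Lemma mink_cyl t s i :
  mink (cyl t s) (e i) = hypot s * (x2 (e i) * (s / hypot s) - level i t).
Proof.
rewrite /mink /cyl /x1 /x2 /x3 /level /slope /=.
by field; rewrite gt_eqF ?hypot_gt0.
Qed.

Lemma H2_cyl t s : H2 (cyl t s).
Proof.
split; last by rewrite /cyl /x3 /= mulr_gt0 ?hypot_gt0.
rewrite /mink /cyl /x1 /x2 /x3 /=.
have := sqr_hypot t; have := sqr_hypot s.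
move: (hypot t) (hypot s) => r q hq hr.
have -> : q * t * (q * t) + s * s - q * r * (q * r) =
  q ^+ 2 * (t ^+ 2 - r ^+ 2) + s ^+ 2 by ring.
by rewrite hq hr; ring.
Qed.

Lemma hpoly_cyl t s :
  hpoly e (cyl t s) <-> forall k, x2 (e k) * (s / hypot s) <= level k t.
Proof.
split=> [[_ h] k|h]; last split => [|k]; [|exact: H2_cyl|].
  by have := h k; rewrite mink_cyl pmulr_rle0 ?hypot_gt0// subr_le0.
by rewrite mink_cyl pmulr_rle0 ?hypot_gt0// subr_le0.
Qed.

Lemma hside_cyl t s i : hpoly e (cyl t s) -> x2 (e i) * (s / hypot s) = level i t ->
  hside e i (cyl t s).
Proof. by move=> h hi; split=> //; rewrite mink_cyl hi subrr mulr0. Qed.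

Hypothesis spacelike : forall i, 0 < mink (e i) (e i).
Hypothesis right_angles : forall i j, i <> j ->
  (hside e i `&` hside e j) !=set0 -> mink (e i) (e j) = 0.

Lemma vertex_orthogonal i j t w : i <> j -> -1 < w < 1 ->
  (forall k, x2 (e k) * w <= level k t) ->
  x2 (e i) * w = level i t -> x2 (e j) * w = level j t -> mink (e i) (e j) = 0.
Proof.
move=> ij w1 hk hi hj; apply: right_angles => //.
have h : hpoly e (cyl t (sigma w)) by apply/hpoly_cyl; rewrite sigmaK.
by exists (cyl t (sigma w)); split; apply: hside_cyl => //; rewrite sigmaK.
Qed.

Lemma theta_spacelike i : x2 (e i) != 0 ->
  0 < 1 + (x1 (e i) / x2 (e i)) ^+ 2 - (x3 (e i) / x2 (e i)) ^+ 2.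
Proof.
move=> b0; have b2 : 0 < (x2 (e i)) ^+ 2 by rewrite exprn_even_gt0.
rewrite -(pmulr_rgt0 _ b2); apply: (lt_le_trans (spacelike i)).
by rewrite /mink le_eqVlt; apply/orP; left; apply/eqP; field.
Qed.

Lemma theta_ideal i t : x2 (e i) != 0 -> graph i t ^+ 2 = 1 -> eqpih (theta i t) 0.
Proof. by move=> b0; apply: ang_ideal; exact: theta_spacelike. Qed.

Lemma theta_orthogonal i j t : x2 (e i) != 0 -> x2 (e j) != 0 ->
  graph i t = graph j t -> -1 < graph i t < 1 -> mink (e i) (e j) = 0 ->
  eqpih (theta i t) (theta j t).
Proof.
move=> bi bj ij w1 m0; apply: ang_orthogonal => //; try exact: theta_spacelike.
have := m0; rewrite /mink => /(congr1 (fun x => x / (x2 (e i) * x2 (e j)))).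
by rewrite mul0r => <-; field; apply/andP.
Qed.

(** Side [k] runs along the slice of parameter [t], so being orthogonal to it means crossing that
    slice at a right angle. *)
Lemma theta_perp i k t : x2 (e i) != 0 -> x2 (e k) = 0 -> level k t = 0 ->
  mink (e i) (e k) = 0 -> theta i t = 0.
Proof.
move=> bi bk lk m0; apply: ang_perp.
have r0 := hypot_gt0 t.
have ck : x3 (e k) = x1 (e k) * t / hypot t.
  by move: lk; rewrite /level /slope => /eqP; rewrite subr_eq0 => /eqP <-; rewrite mulfK ?gt_eqF.
have ak : x1 (e k) != 0.
  apply/eqP => ak; have := spacelike k.
  by rewrite /mink ck ak bk !mul0r addr0 subr0 ltxx.
move: m0; rewrite /mink bk mulr0 addr0 ck => m0.
have : x1 (e k) * (x1 (e i) * hypot t - x3 (e i) * t) = 0.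
  by rewrite -[RHS](mul0r (hypot t)) -m0; field; rewrite gt_eqF.
move=> /eqP; rewrite mulf_eq0 (negbTE ak) subr_eq0 => /eqP h.
by rewrite mulrAC -h mulrAC.
Qed.

Definition upper i t := 0 < x2 (e i) /\ forall k, 0 < x2 (e k) -> graph i t <= graph k t.

Definition lower j t := x2 (e j) < 0 /\ forall k, x2 (e k) < 0 -> graph k t <= graph j t.

Lemma upper_lower_feasible i j t w : upper i t -> lower j t ->
  (forall k, x2 (e k) = 0 -> 0 <= level k t) ->
  graph j t <= w <= graph i t -> forall k, x2 (e k) * w <= level k t.
Proof.
move=> [bi hi] [bj hj] hv /andP[jw wi] k.
have [bk|bk|bk] := ltgtP (x2 (e k)) 0.
- rewrite levelE ?lt_eqF// ler_nM2l//; exact: le_trans (hj k bk) jw.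
- rewrite levelE ?gt_eqF// ler_pM2l//; exact: le_trans wi (hi k bk).
- by rewrite bk mul0r hv.
Qed.

(* The slice of parameter [t] has interior points. *)
Definition inner t :=
  [/\ forall k, x2 (e k) = 0 -> 0 < level k t,
      forall i, 0 < x2 (e i) -> -1 < graph i t,
      forall j, x2 (e j) < 0 -> graph j t < 1 &
      forall i j, 0 < x2 (e i) -> x2 (e j) < 0 -> graph j t < graph i t].

(** When the upper boundary is at [w = 1], each side reaching it there has angle congruent to [0] by
    [theta_ideal]; hence the default value. *)
Definition upper_angle t : R :=
  if pselect (exists i, upper i t /\ -1 < graph i t < 1) is left h
  then theta (projT1 (cid h)) t else 0.

Definition lower_angle t : R :=
  if pselect (exists j, lower j t /\ -1 < graph j t < 1) is left h
  then theta (projT1 (cid h)) t else 0.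

(* Only the class of [angle t] modulo [pi/2] matters: by [theta_angle] it does not
   depend on the sides chosen at [t]. *)
Definition angle t : R :=
  if pselect (inner t) then upper_angle t - lower_angle t else 0.

(** This is where right angles enter. On an inner slice, two candidates for the same boundary meet
    in a vertex, so their angles differ by a multiple of [pi/2], or at an ideal point, where the
    class is [0]. On any other slice, either the two boundaries meet, in a vertex or an ideal point,
    or a side lies along the slice and each boundary is orthogonal to it or ends at an ideal
    point. *)
Lemma theta_angle i j t : upper i t -> lower j t ->
  -1 <= graph j t -> graph j t <= graph i t -> graph i t <= 1 ->
  (forall k, x2 (e k) = 0 -> 0 <= level k t) ->
  eqpih (theta i t - theta j t) (angle t).
Proof.
move=> ui lj wj ji wi hv.
have bi : x2 (e i) != 0 by case: ui => ? _; rewrite gt_eqF.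
have bj : x2 (e j) != 0 by case: lj => ? _; rewrite lt_eqF.
have feas w : graph j t <= w <= graph i t -> forall k, x2 (e k) * w <= level k t.
  exact: upper_lower_feasible.
rewrite /angle; case: pselect => [[U1 U2 U3 U4]|nU].
  apply: eqpihB.
  - rewrite /upper_angle; case: pselect => [h|nh].
      case: (cid h) => k [uk wk] /=.
      have [->|/eqP ik] := eqVneq i k; first exact: eqpih_refl.
      have bk : x2 (e k) != 0 by case: uk => ? _; rewrite gt_eqF.
      have wik : graph i t = graph k t.
        by apply/eqP; rewrite eq_le (proj2 ui _ (proj1 uk)) (proj2 uk _ (proj1 ui)).
      apply: theta_orthogonal => //; first by rewrite wik.
      apply: (@vertex_orthogonal i k t (graph i t)) => //.
      + by rewrite wik.
      + by apply: feas; rewrite ji lexx.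
      + by rewrite levelE.
      + by rewrite levelE// wik.
    apply: theta_ideal => //.
    have [w1|w1] := eqVneq (graph i t) 1; first by rewrite w1 expr1n.
    exfalso; apply: nh; exists i; split => //.
    rewrite U2 ?(proj1 ui)//=; rewrite lt_neqAle w1//.
  - rewrite /lower_angle; case: pselect => [h|nh].
      case: (cid h) => k [uk wk] /=.
      have [->|/eqP ik] := eqVneq j k; first exact: eqpih_refl.
      have bk : x2 (e k) != 0 by case: uk => ? _; rewrite lt_eqF.
      have wik : graph j t = graph k t.
        by apply/eqP; rewrite eq_le (proj2 uk _ (proj1 lj)) (proj2 lj _ (proj1 uk)).
      apply: theta_orthogonal => //; first by rewrite wik.
      apply: (@vertex_orthogonal j k t (graph j t)) => //.
      + by rewrite wik.
      + by apply: feas; rewrite ji lexx.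
      + by rewrite levelE.
      + by rewrite levelE// wik.
    apply: theta_ideal => //.
    have [w1|w1] := eqVneq (graph j t) (-1); first by rewrite w1 sqrrN expr1n.
    exfalso; apply: nh; exists j; split => //.
    rewrite U3 ?(proj1 lj)// andbT lt_neqAle eq_sym w1//.
have [wij|wij] := eqVneq (graph j t) (graph i t).
  have [wi1|wi1] := eqVneq (graph i t ^+ 2) 1.
    rewrite -[X in eqpih _ X](subr0 0); apply: eqpihB; apply: theta_ideal => //.
    by rewrite wij.
  have w1 : -1 < graph i t < 1.
    have h1 : -1 <= graph i t <= 1 by lra.
    have h2 : graph i t != 1 by apply: contraNN wi1 => /eqP ->; rewrite expr1n.
    have h3 : graph i t != -1 by apply: contraNN wi1 => /eqP ->; rewrite sqrrN expr1n.
    case/andP: h1 => h4 h5.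
    by rewrite !lt_neqAle h2 h4 h5 eq_sym h3.
  have h : eqpih (theta i t) (theta j t).
    apply: theta_orthogonal => //.
    apply: (@vertex_orthogonal i j t (graph i t)) => //.
    + by move=> ij; case: ui lj => + _ [+ _]; rewrite ij; lra.
    + by apply: feas; rewrite wij lexx.
    + by rewrite levelE.
    + by rewrite levelE// wij.
  by rewrite -(subrr (theta j t)); apply: eqpihB => //; exact: eqpih_refl.
have ltji : graph j t < graph i t by rewrite lt_neqAle wij.
(* The strict inequality between the two boundaries gives all other conditions of [inner], so only a
   side along the slice can make it fail. *)
have [k [bk lk]] : exists k, x2 (e k) = 0 /\ level k t = 0.
  apply: contrapT => nk; apply: nU; split.
  - move=> k bk; rewrite lt_neqAle hv// andbT; apply/eqP => l0.
    by apply: nk; exists k.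
  - by move=> k bk; case: ui => _ /(_ k bk); lra.
  - by move=> k bk; case: lj => _ /(_ k bk); lra.
  - by move=> k l bk bl; case: lj => _ /(_ l bl); case: ui => _ /(_ k bk); lra.
have key l w : x2 (e l) != 0 -> graph l t = w -> graph j t <= w <= graph i t ->
    eqpih (theta l t) 0.
  move=> bl lw wji.
  have [w1|w1] := eqVneq (w ^+ 2) 1; first by apply: theta_ideal => //; rewrite lw.
  rewrite (theta_perp l k)//; first exact: eqpih_refl.
  apply: (@vertex_orthogonal l k t w).
  + by move=> lk'; move: bl; rewrite lk' bk eqxx.
  + have h1 : -1 <= w <= 1 by lra.
    have h2 : w != 1 by apply: contraNN w1 => /eqP ->; rewrite expr1n.
    have h3 : w != -1 by apply: contraNN w1 => /eqP ->; rewrite sqrrN expr1n.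
    case/andP: h1 => h4 h5.
    by rewrite !lt_neqAle h2 h4 h5 eq_sym h3.
  + exact: feas.
  + by rewrite levelE// lw.
  + by rewrite bk mul0r lk.
rewrite -[X in eqpih _ X](subr0 0); apply: eqpihB.
  by apply: (key i (graph i t)) => //; rewrite ji lexx.
by apply: (key j (graph j t)) => //; rewrite ji lexx.
Qed.

End polygon.

(** * Lengths of the slices *)

Section slices.
Context {R : realType} {n : nat} (e : 'I_n -> pt R).
Local Notation mu := (@lebesgue_measure R).
Implicit Types (i j k : 'I_n) (t s w p q : R).

Lemma measurable_hpoly : measurable [set p : R * R | hpoly e (hlift p)].
Proof.
have m1 : measurable_fun [set: measurableTypeR R * measurableTypeR R]
  (fst : _ -> R) by exact: measurable_fst.
have m2 : measurable_fun [set: measurableTypeR R * measurableTypeR R]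
  (snd : _ -> R) by exact: measurable_snd.
have -> : [set p : R * R | hpoly e (hlift p)] =
    \bigcap_(k in [set: 'I_n]) [set p : R * R | mink (hlift p) (e k) <= 0].
  apply/seteqP; split => [p [_ h] k _|p h]; first exact: h.
  split => [|k]; last exact: h.
  case: p {h} => x y.
  rewrite (_ : x = hypot y * (x / hypot y)); last first.
    by rewrite mulrC divfK// gt_eqF ?hypot_gt0.
  by rewrite hlift_cyl; exact: H2_cyl.
apply: fin_bigcap_measurable => // k _.
pose f (p : R * R) := mink (hlift p) (e k).
have mf : measurable_fun [set: measurableTypeR R * measurableTypeR R] (f : _ -> R).
  rewrite (_ : f = fun p : R * R => p.1 * x1 (e k) + p.2 * x2 (e k) -
      hypot (Num.sqrt (p.1 ^+ 2 + p.2 ^+ 2)) * x3 (e k)); last first.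
    apply/funext => p; rewrite /f /mink /hlift /x1 /x2 /x3 /= /hypot.
    by rewrite sqr_sqrtr ?addr_ge0 ?sqr_ge0// addrA.
  have msqrt : measurable_fun [set: R] (@Num.sqrt R).
    by apply: continuous_measurable_fun; exact: sqrt_continuous.
  apply: measurable_funB; first by apply: measurable_funD; exact: measurable_funM.
  apply: measurable_funM => //.
  apply: (measurableT_comp measurable_hypot); apply: (measurableT_comp msqrt).
  by apply: measurable_funD; exact: measurable_funX.
rewrite (_ : [set p | _] = setT `&` f @^-1` `]-oo, 0]%classic); last first.
  by apply/seteqP; split => p /=; rewrite in_itv//= => -[].
exact: mf.
Qed.

Lemma continuous_tau : continuous (fun s : R => s / hypot s).
Proof.
move=> s; apply: cvgM; first exact: cvg_id.
by apply: cvgV; [rewrite gt_eqF ?hypot_gt0 | exact: continuous_hypot].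
Qed.

Lemma measurable_slice t : measurable [set s | hpoly e (cyl t s)].
Proof.
have -> : [set s | hpoly e (cyl t s)] = \bigcap_(k in [set: 'I_n])
    [set s | x2 (e k) * (s / hypot s) <= level e k t].
  apply/seteqP; split => [s /hpoly_cyl h k _|s h]; first exact: h.
  by apply/hpoly_cyl => k; exact: h.
apply: fin_bigcap_measurable => // k _.
pose f s : R := x2 (e k) * (s / hypot s).
have mf : measurable_fun [set: R] f.
  apply: measurable_funM => //; apply: continuous_measurable_fun.
  exact: continuous_tau.
rewrite (_ : [set p | _] = setT `&` f @^-1` `]-oo, level e k t]%classic); last first.
  by apply/seteqP; split => p /=; rewrite in_itv//= => -[].
exact: mf.
Qed.

Definition width t : \bar R := ((hypot t)^-1%:E * mu [set s | hpoly e (cyl t s)])%E.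

Lemma width_ge0 t : (0 <= width t)%E.
Proof. by rewrite mule_ge0// lee_fin invr_ge0 ltW// hypot_gt0. Qed.

Lemma measurable_width : measurable_fun setT width.
Proof. by have [] := harea_slices _ measurable_hpoly. Qed.

Lemma harea_width : harea (hpoly e) = (\int[mu]_t width t)%E.
Proof. by have [] := harea_slices _ measurable_hpoly. Qed.

Lemma width_ge t (X : set R) : measurable X ->
  X `<=` [set s | hpoly e (cyl t s)] -> ((hypot t)^-1%:E * mu X <= width t)%E.
Proof.
move=> mX XS; rewrite lee_pmul2l// ?lte_fin ?invr_gt0 ?hypot_gt0//.
by rewrite le_measure// inE//; exact: measurable_slice.
Qed.

Lemma width_between i j t : upper e i t -> lower e j t ->
  -1 < graph e j t -> graph e j t < graph e i t -> graph e i t < 1 ->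
  (forall k, x2 (e k) = 0 -> 0 <= level e k t) ->
  (((sigma (graph e i t) - sigma (graph e j t)) / hypot t)%:E <= width t)%E.
Proof.
move=> ui lj wj ji wi hv.
have w1 : -1 < graph e i t < 1 by lra.
have w2 : -1 < graph e j t < 1 by lra.
have := width_ge t `[sigma (graph e j t), sigma (graph e i t)]%classic.
rewrite lebesgue_measure_itv/= lte_fin sigma_lt// ji -EFinB -EFinM mulrC; apply.
  exact: measurable_itv.
move=> s /=; rewrite in_itv/= => /andP[s1 s2]; apply/hpoly_cyl.
by apply: (upper_lower_feasible e i j t) => //; rewrite tau_le// tau_ge// s1.
Qed.

Lemma fin_bound (P : pred 'I_n) (f : 'I_n -> R) : (forall i, P i -> f i < 1) ->
  exists2 c, -1 < c < 1 & forall i, P i -> f i <= c.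
Proof.
(* Starting the maximum at [0] keeps the bound above [-1], even when no index satisfies [P]. *)
move=> h; exists (\big[Num.max/0]_(i | P i) f i).
  apply/andP; split; last exact: bigmax_lt.
  by apply: (@lt_le_trans _ _ 0); [exact: ltrN10 | exact: bigmax_ge_id].
by move=> i Pi; exact: le_bigmax_cond.
Qed.

(** Nothing stops [w] before [1], and [sigma w] is unbounded there. *)
Lemma width_infty_above t : inner e t -> (forall i, 0 < x2 (e i) -> 1 <= graph e i t) ->
  width t = +oo%E.
Proof.
move=> [U1 U2 U3 U4] ub; apply/eqP; rewrite -leye_eq.
have [c c1 hc] := fin_bound (fun j => x2 (e j) < 0) (graph e ^~ t) U3.
have := width_ge t `[sigma c, +oo[%classic (measurable_itv _).
rewrite lebesgue_measure_itv/= ?ltry ?ltNyr/= gt0_muley ?lte_fin ?invr_gt0 ?hypot_gt0//; apply.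
move=> s /=; rewrite in_itv/= andbT -tau_ge// => cs; apply/hpoly_cyl => k.
have /andP[s1 s2] := tau_ltr1 s.
have [bk|bk|bk] := ltgtP (x2 (e k)) 0.
- rewrite levelE ?lt_eqF// ler_nM2l//; exact: le_trans (hc k bk) cs.
- rewrite levelE ?gt_eqF// ler_pM2l//; exact: le_trans (ltW s2) (ub k bk).
- by rewrite bk mul0r ltW// U1.
Qed.

Lemma width_infty_below t : inner e t -> (forall i, x2 (e i) < 0 -> graph e i t <= -1) ->
  width t = +oo%E.
Proof.
move=> [U1 U2 U3 U4] ub; apply/eqP; rewrite -leye_eq.
have [c c1 hc] : exists2 c, -1 < c < 1 & forall i, 0 < x2 (e i) -> c <= graph e i t.
  have [|c c1 hc] := fin_bound (fun j => 0 < x2 (e j)) (fun j => - graph e j t).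
    by move=> i /U2; lra.
  by exists (- c); [lra | move=> i /hc; lra].
have := width_ge t `]-oo, sigma c]%classic (measurable_itv _).
rewrite lebesgue_measure_itv/= ?ltry ?ltNyr/= gt0_muley ?lte_fin ?invr_gt0 ?hypot_gt0//; apply.
move=> s /=; rewrite in_itv/= -tau_le// => cs; apply/hpoly_cyl => k.
have /andP[s1 s2] := tau_ltr1 s.
have [bk|bk|bk] := ltgtP (x2 (e k)) 0.
- rewrite levelE ?lt_eqF// ler_nM2l//; exact: le_trans (ub k bk) (ltW s1).
- rewrite levelE ?gt_eqF// ler_pM2l//; exact: le_trans cs (hc k bk).
- by rewrite bk mul0r ltW// U1.
Qed.

(** [inner] consists of finitely many strict inequalities between continuous functions. Openness
    excludes an inner end slice for an interval without inner slices. *)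
Lemma near_inner t : inner e t -> \forall u \near t, inner e u.
Proof.
move=> [U1 U2 U3 U4].
have pos (f : R -> R) : continuous f -> 0 < f t -> \forall u \near t, 0 < f u.
  by move=> cf f0; exact: (cvgr_gt _ (cf t)).
have fa (P : 'I_n -> R -> Prop) : (forall k, \forall u \near t, P k u) ->
    \forall u \near t, forall k, P k u by exact: (@filter_forall _ _ P (nbhs t) (nbhs_filter t)).
have : \forall u \near t, forall k, x2 (e k) = 0 -> 0 < level e k u.
  apply: (fa (fun k u => _ -> _)) => k; have [bk|bk] := eqVneq (x2 (e k)) 0; last first.
    by apply: filterE => u bk'; rewrite bk' eqxx in bk.
  by have := pos _ (continuous_level e k) (U1 k bk); apply: filterS.
have : \forall u \near t, forall k, 0 < x2 (e k) -> -1 < graph e k u.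
  apply: (fa (fun k u => _ -> _)) => k; have [bk|bk] := ltP 0 (x2 (e k)); last first.
    by apply: filterE => u; lra.
  have c1 : continuous (fun u => graph e k u + 1).
    by move=> u; apply: cvgD; [exact: continuous_graph | exact: cvg_cst].
  have := pos _ c1; rewrite -ltrBlDr sub0r => /(_ (U2 k bk)); apply: filterS => u; lra.
have : \forall u \near t, forall k, x2 (e k) < 0 -> graph e k u < 1.
  apply: (fa (fun k u => _ -> _)) => k; have [bk|bk] := ltP (x2 (e k)) 0; last first.
    by apply: filterE => u; lra.
  have c1 : continuous (fun u => 1 - graph e k u).
    by move=> u; apply: cvgB; [exact: cvg_cst | exact: continuous_graph].
  have := pos _ c1; rewrite subr_gt0 => /(_ (U3 k bk)); apply: filterS => u; lra.
have : \forall u \near t, forall k l, 0 < x2 (e k) -> x2 (e l) < 0 -> graph e l u < graph e k u.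
  apply: (fa (fun k u => forall l, _ -> _ -> _)) => k.
  apply: (fa (fun l u => _ -> _ -> _)) => l.
  have [bk|bk] := ltP 0 (x2 (e k)); last by apply: filterE => u; lra.
  have [bl|bl] := ltP (x2 (e l)) 0; last by apply: filterE => u; lra.
  have c1 : continuous (fun u => graph e k u - graph e l u).
    by move=> u; apply: cvgB; exact: continuous_graph.
  have := pos _ c1; rewrite subr_gt0 => /(_ (U4 k l bk bl)); apply: filterS => u; lra.
move=> H1 H2 H3 H4; near=> u; split.
- by near: u.
- by near: u.
- by near: u.
- by near: u.
Unshelve. all: by end_near. Qed.

End slices.

(** * Adding up intervals of slices *)

Section pieces.
Context {R : realType} {n : nat} (e : 'I_n -> pt R).
Local Notation mu := (@lebesgue_measure R).
Implicit Types (i j k l : 'I_n) (t s w p q : R).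

Lemma breakpoint_ind (T : R -> R -> Prop) :
  (forall p q r, p < q -> q < r -> T p q -> T q r -> T p r) ->
  forall s : seq R,
  (forall p q, p < q -> (forall x, x \in s -> ~~ (p < x < q)) -> T p q) ->
  forall p q, p < q -> T p q.
Proof.
move=> Ttrans s Ts p q pq.
suff : forall (s' : seq R) a b, a < b -> (forall x, x \in s -> a < x < b -> x \in s') -> T a b.
  by move=> /(_ s p q pq); apply.
elim=> [|y s' IH] a b ab hs.
  by apply: Ts => // x xs; apply/negP => /(hs _ xs).
have [/andP[ay yb]|ny] := boolP (a < y < b).
  apply: (Ttrans a y b) => //; apply: IH => // x xs /andP[ax xb].
    have := hs x xs; rewrite ax (lt_trans xb yb) in_cons => /(_ isT) /orP[/eqP xy|//].
    by move: xb; rewrite xy ltxx.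
  have := hs x xs; rewrite xb (lt_trans ay ax) in_cons => /(_ isT) /orP[/eqP xy|//].
  by move: ax; rewrite xy ltxx.
apply: IH => // x xs xab; have := hs x xs xab; rewrite in_cons => /orP[/eqP xy|//].
by move: ny; rewrite -xy xab.
Qed.

Definition same_sign (f : R -> R) p q := forall t t', p < t < q -> p < t' < q ->
  (0 < f t -> 0 < f t') /\ (f t < 0 -> f t' < 0).

(** These signs decide whether a slice is inner, which sides bound it, and whether it is infinite;
    on a regular interval none of this depends on [t]. *)
Definition regular p q :=
  [/\ forall k, same_sign (level e k) p q,
      forall k, same_sign (fun t => graph e k t - 1) p q,
      forall k, same_sign (fun t => graph e k t + 1) p q &
      forall k l, same_sign (fun t => graph e k t - graph e l t) p q].

Lemma breakpoints : exists s : seq R, forall p q,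
  (forall x, x \in s -> ~~ (p < x < q)) -> regular p q.
Proof.
have fin (I : finType) (f : I -> R -> R) :
    (forall i : I, exists s : seq R, forall p q,
      (forall x, x \in s -> ~~ (p < x < q)) -> same_sign (f i) p q) ->
    exists s : seq R, forall p q,
      (forall x, x \in s -> ~~ (p < x < q)) -> forall i : I, same_sign (f i) p q.
  move=> /choice[g hg]; exists (flatten [seq g v | v <- enum I]) => p q h v.
  apply: hg => x xg; apply: h; apply/flattenP; exists (g v) => //.
  by apply: map_f; rewrite mem_enum.
have [|s1 h1] := fin 'I_n (level e).
  move=> k; have [s hs] := slope_sign (x1 (e k)) (x3 (e k)) 0; exists s => p q h t t' tp t'p.
  by have := hs p q h t t' tp t'p; rewrite !subr0.
have [|s2 h2] := fin 'I_n (fun k t => graph e k t - 1).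
  by move=> k; have [s hs] := slope_sign (x1 (e k) / x2 (e k)) (x3 (e k) / x2 (e k)) 1; exists s.
have [|s3 h3] := fin 'I_n (fun k t => graph e k t + 1).
  move=> k; have [s hs] := slope_sign (x1 (e k) / x2 (e k)) (x3 (e k) / x2 (e k)) (-1).
  exists s => p q h t t' tp t'p.
  by have := hs p q h t t' tp t'p; rewrite !opprK.
have [|s4 h4] := fin ('I_n * 'I_n)%type (fun kl t => graph e kl.1 t - graph e kl.2 t).
  (* [slope] is linear in its two coefficients, so a difference of graphs is again a slope. *)
  move=> [k l]; have [s hs] := slope_sign (x1 (e k) / x2 (e k) - x1 (e l) / x2 (e l))
    (x3 (e k) / x2 (e k) - x3 (e l) / x2 (e l)) 0.
  exists s => p q h t t' tp t'p.
  have := hs p q h t t' tp t'p; rewrite !subr0 /=.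
  have E u : slope (x1 (e k) / x2 (e k) - x1 (e l) / x2 (e l))
    (x3 (e k) / x2 (e k) - x3 (e l) / x2 (e l)) u = graph e k u - graph e l u.
    by rewrite /graph /slope; ring.
  by rewrite !E.
exists (s1 ++ s2 ++ s3 ++ s4) => p q h.
split.
- by apply: h1 => x xs; apply: h; rewrite mem_cat xs.
- by apply: h2 => x xs; apply: h; rewrite !mem_cat xs orbT.
- by apply: h3 => x xs; apply: h; rewrite !mem_cat xs !orbT.
- move=> k l; apply: (h4 p q _ (k, l)) => x xs; apply: h.
  by rewrite !mem_cat xs !orbT.
Qed.

Lemma regular_inner p q t t' : regular p q -> p < t < q -> p < t' < q ->
  inner e t -> inner e t'.
Proof.
move=> [h1 h2 h3 h4] tp t'p [U1 U2 U3 U4]; split.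
- by move=> k bk; apply: (h1 k t t' tp t'p).1; exact: U1.
- by move=> k bk; have := (h3 k t t' tp t'p).1; have := U2 k bk; lra.
- by move=> k bk; have := (h2 k t t' tp t'p).2; have := U3 k bk; lra.
- by move=> k l bk bl; have := (h4 k l t t' tp t'p).1; have := U4 k l bk bl; lra.
Qed.

(** [D = 0] must be allowed on intervals that miss the polygon; the second clause recovers strict
    positivity when the first slice is inner. *)
Definition contributes p q (D : R) :=
  [/\ 0 <= D, (inner e p -> 0 < D),
     (D%:E <= \int[mu]_(t in `]p, q[) width e t)%E &
     eqpih D (angle e q - angle e p)].

Lemma contributes_trans p q r D D' : p < q -> q < r ->
  contributes p q D -> contributes q r D' -> contributes p r (D + D').
Proof.
move=> pq qr [D0 Dp DI DE] [D'0 D'p D'I D'E]; split.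
- exact: addr_ge0.
- by move=> /Dp ?; rewrite ltr_pwDl.
- rewrite EFinD; apply: le_trans (leeD DI D'I) _.
  rewrite -ge0_integral_setU//=.
  + apply: ge0_subset_integral => //.
    * exact: measurableU.
    * exact: measurable_funS (measurable_width e).
    * by move=> t _; exact: width_ge0.
    * by move=> t /= []; rewrite !in_itv/= => /andP[? ?]; apply/andP; lra.
  + exact: measurable_funS (measurable_width e).
  + by move=> t _; exact: width_ge0.
  + apply/disj_setPS => t /= []; rewrite !in_itv/= => /andP[? ?] /andP[? ?]; lra.
- rewrite (_ : angle e r - angle e p = (angle e q - angle e p) + (angle e r - angle e q)); last by ring.
  exact: eqpihD.
Qed.

(** The integral exceeds every number, so enough multiples of [pi/2] are added to the required class
    to make it positive. *)
Lemma contributes_infty p q : p < q ->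
  (forall t, p < t < q -> width e t = +oo%E) -> exists D, contributes p q D.
Proof.
move=> pq winf.
pose d := angle e q - angle e p.
have pi2 : 0 < pi / 2 :> R by have := pi_gt0 R; lra.
pose N := Num.bound (`|d| / (pi / 2)).
have dN : `|d| < N%:R * (pi / 2).
  by rewrite -ltr_pdivrMr// archi_boundP// divr_ge0// ltW.
have d1 : - `|d| <= d by rewrite lerNl ler_normr lexx orbT.
have D0 : 0 < d + N%:R * (pi / 2) by lra.
exists (d + N%:R * (pi / 2)); split => //; first exact: ltW.
  set D := d + _ in D0 *.
  have -> : D%:E = (\int[mu]_(t in `]p, q[) (D / (q - p))%:E)%E.
    rewrite integral_cst//= lebesgue_measure_itv/= lte_fin pq -EFinB -EFinM.
    by rewrite divfK// subr_eq0 gt_eqF.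
  apply: ge0_le_integral => //.
  - by move=> t _; rewrite lee_fin divr_ge0// ltW// subr_gt0.
  - exact: measurable_funS (measurable_width e).
  - by move=> t /=; rewrite in_itv/= => /winf ->; rewrite leey.
by exists N%:Z; rewrite addrC addKr.
Qed.

Lemma closure_ge0 (f : R -> R) p q : p < q -> continuous f ->
  (forall t, p < t < q -> 0 <= f t) -> 0 <= f p /\ 0 <= f q.
Proof.
move=> pq cf h; split.
- apply: (cvgr_to_ge (cvg_at_right_filter (cf p))).
  near=> t; apply: h; apply/andP; split; near: t.
    exact: nbhs_right_gt.
  exact: nbhs_right_lt.
- apply: (cvgr_to_ge (cvg_at_left_filter (cf q))).
  near=> t; apply: h; apply/andP; split; near: t.
    exact: nbhs_left_gt.
  exact: nbhs_left_lt.
Unshelve. all: by end_near. Qed.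

Lemma continuous_sigma w : -1 < w < 1 -> {for w, continuous (@sigma R)}.
Proof.
move=> w1; have w0 : 0 < 1 - w ^+ 2 by nra.
have h : Num.sqrt (1 - u ^+ 2) @[u --> w] --> Num.sqrt (1 - w ^+ 2).
  apply: continuous_comp; last exact: sqrt_continuous.
  by apply: cvgB; [exact: cvg_cst | exact: exprn_continuous].
apply: cvgM; first exact: cvg_id.
by apply: (cvgV _ h); rewrite gt_eqF ?sqrtr_gt0.
Qed.

Hypothesis spacelike : forall i, 0 < mink (e i) (e i).
Hypothesis right_angles : forall i j, i <> j ->
  (hside e i `&` hside e j) !=set0 -> mink (e i) (e j) = 0.

Lemma contributes_between i j p q : p < q ->
  (forall t, p < t < q -> inner e t) ->
  (forall t, p < t < q -> upper e i t) -> (forall t, p < t < q -> lower e j t) ->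
  (forall t, p < t < q -> -1 < graph e j t) ->
  (forall t, p < t < q -> graph e i t < 1) ->
  exists D, contributes p q D.
Proof.
move=> pq hU ui lj wj wi.
have m1 : p < (p + q) / 2 < q by lra.
have bi : 0 < x2 (e i) by case: (ui _ m1).
have bj : x2 (e j) < 0 by case: (lj _ m1).
have ji t : p < t < q -> graph e j t < graph e i t.
  by move=> /hU[_ _ _]; apply.
pose G t := theta e i t - theta e j t.
pose h t := (sigma (graph e i t) - sigma (graph e j t)) / hypot t.
have w1 t : p < t < q -> -1 < graph e i t < 1.
  by move=> tp; have := wj t tp; have := ji t tp; have := wi t tp; lra.
have w2 t : p < t < q -> -1 < graph e j t < 1.
  by move=> tp; have := wj t tp; have := ji t tp; have := wi t tp; lra.
have cG : continuous G by move=> t; apply: cvgB; exact: continuous_theta.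
have dG t : p < t < q -> is_derive t (1 : R) G (h t).
  move=> tp; rewrite /h mulrBl; apply: is_deriveB.
    by apply: is_derive_ang; [apply: theta_spacelike => //; rewrite gt_eqF | exact: w1].
  by apply: is_derive_ang; [apply: theta_spacelike => //; rewrite lt_eqF | exact: w2].
have ch t : p < t < q -> {for t, continuous h}.
  move=> tp.
  have hh : hypot u @[u --> t] --> hypot t by exact: continuous_hypot.
  apply: cvgM; last by apply: (cvgV _ hh); rewrite gt_eqF ?hypot_gt0.
  apply: cvgB.
    apply: continuous_comp; first exact: continuous_graph.
    exact: continuous_sigma (w1 t tp).
  apply: continuous_comp; first exact: continuous_graph.
  exact: continuous_sigma (w2 t tp).
have h0 t : p < t < q -> 0 < h t.
  move=> tp; rewrite divr_gt0 ?hypot_gt0// subr_gt0 sigma_lt//; first exact: ji.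
    exact: w2.
  exact: w1.
have Gpq := antiderivative_lt G h p q pq cG dG h0.
(* The premise says that [t] inherits the non-strict inequalities valid on the open interval;
   [closure_ge0] provides it for [p] and for [q]. *)
have ends t : (forall f : R -> R, continuous f -> (forall u, p < u < q -> 0 <= f u) -> 0 <= f t) ->
    eqpih (G t) (angle e t).
  move=> cl; apply: theta_angle => //.
  - split=> // k bk; rewrite -subr_ge0; apply: (cl (fun t => graph e k t - graph e i t)).
      by move=> u; apply: cvgB; exact: continuous_graph.
    by move=> u up; rewrite subr_ge0; case: (ui u up) => _; apply.
  - split=> // k bk; rewrite -subr_ge0; apply: (cl (fun t => graph e j t - graph e k t)).
      by move=> u; apply: cvgB; exact: continuous_graph.
    by move=> u up; rewrite subr_ge0; case: (lj u up) => _; apply.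
  - rewrite -subr_ge0; apply: (cl (fun t => graph e j t - -1)).
      by move=> u; apply: cvgB; [exact: continuous_graph | exact: cvg_cst].
    by move=> u up; rewrite subr_ge0 ltW// wj.
  - rewrite -subr_ge0; apply: (cl (fun t => graph e i t - graph e j t)).
      by move=> u; apply: cvgB; exact: continuous_graph.
    by move=> u up; rewrite subr_ge0 ltW// ji.
  - rewrite -subr_ge0; apply: (cl (fun t => 1 - graph e i t)).
      by move=> u; apply: cvgB; [exact: cvg_cst | exact: continuous_graph].
    by move=> u up; rewrite subr_ge0 ltW// wi.
  - move=> k bk; apply: (cl (level e k)); first exact: continuous_level.
    by move=> u up; rewrite ltW//; case: (hU u up) => + _ _ _; apply.
exists (G q - G p); split.
- by rewrite subr_ge0 ltW.
- by rewrite subr_gt0.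
- apply: (integral_ge_antiderivative G h) => //.
  + exact: measurable_width.
  + exact: width_ge0.
  + move=> t tp; apply: width_between; [exact: ui | exact: lj | exact: wj | exact: ji | exact: wi |].
    by move=> k bk; rewrite ltW//; case: (hU t tp) => + _ _ _; apply.
- apply: eqpihB; apply: ends => f cf fp.
    by have [] := closure_ge0 f p q pq cf fp.
  by have [] := closure_ge0 f p q pq cf fp.
Qed.

(** The midpoint decides between three cases: no inner slice, infinite slices, or a lowest upper
    side and a highest lower side, which keep these roles on the whole interval. *)
Lemma contributes_regular p q : p < q -> regular p q -> exists D, contributes p q D.
Proof.
move=> pq reg; pose m := (p + q) / 2.
have mp : p < m < q by rewrite /m; lra.
have [Um|nUm] := pselect (inner e m); last first.
  have nU t : p < t < q -> ~ inner e t.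
    by move=> tp Ut; apply: nUm; exact: (regular_inner p q t m reg tp mp Ut).
  have nUp : ~ inner e p.
    move=> Up; near p^'+ => t; apply: (nU t).
      by apply/andP; split; near: t; [exact: nbhs_right_gt | exact: nbhs_right_lt].
    by near: t; rewrite near_withinE; apply: filterS (near_inner e p Up) => u + _.
  have nUq : ~ inner e q.
    move=> Uq; near q^'- => t; apply: (nU t).
      by apply/andP; split; near: t; [exact: nbhs_left_gt | exact: nbhs_left_lt].
    by near: t; rewrite near_withinE; apply: filterS (near_inner e q Uq) => u + _.
  exists 0; split => //.
  - by apply: integral_ge0 => t _; exact: width_ge0.
  - rewrite /angle; case: pselect => [//|nq]; case: pselect => [//|np].
    by rewrite subrr; exact: eqpih_refl.
have hU t : p < t < q -> inner e t by move=> tp; exact: (regular_inner p q m t reg mp tp Um).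
case: (reg) => r1 r2 r3 r4.
have [[i0 [bi0 wi0]]|nu] := pselect (exists i, 0 < x2 (e i) /\ graph e i m < 1); last first.
  apply: contributes_infty => // t tp; apply: width_infty_above; first exact: hU.
  move=> k bk; rewrite leNgt; apply/negP => wk; apply: nu; exists k; split=> //.
  by have := (r2 k t m tp mp).2; lra.
have [[j0 [bj0 wj0]]|nl] := pselect (exists j, x2 (e j) < 0 /\ -1 < graph e j m); last first.
  apply: contributes_infty => // t tp; apply: width_infty_below; first exact: hU.
  move=> k bk; rewrite leNgt; apply/negP => wk; apply: nl; exists k; split=> //.
  by have := (r3 k t m tp mp).1; lra.
have [i bi hi] : exists2 i, 0 < x2 (e i) & forall k, 0 < x2 (e k) -> graph e i m <= graph e k m.
  by case: (@arg_minP _ _ _ i0 (fun k => 0 < x2 (e k)) (graph e ^~ m) bi0) => i; exists i.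
have [j bj hj] : exists2 j, x2 (e j) < 0 & forall k, x2 (e k) < 0 -> graph e k m <= graph e j m.
  by case: (@arg_maxP _ _ _ j0 (fun k => x2 (e k) < 0) (graph e ^~ m) bj0) => j; exists j.
apply: (contributes_between i j) => //.
- move=> t tp; split=> // k bk; rewrite leNgt; apply/negP => wk.
  by have := (r4 i k t m tp mp).1; have := hi k bk; lra.
- move=> t tp; split=> // k bk; rewrite leNgt; apply/negP => wk.
  by have := (r4 k j t m tp mp).1; have := hj k bk; lra.
- move=> t tp; have := (r3 j m t mp tp).1; have := hj j0 bj0; lra.
- move=> t tp; have := (r2 i m t mp tp).2; have := hi i0 bi0; lra.
Unshelve. all: by end_near. Qed.

Lemma contributes_exists p q : p < q -> exists D, contributes p q D.
Proof.
have [s hs] := breakpoints.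
move: p q; apply: (breakpoint_ind (fun p q => exists D, contributes p q D) _ s).
  move=> p q r pq qr [D HD] [D' HD'].
  by exists (D + D'); exact: contributes_trans HD HD'.
by move=> p q pq h; apply: contributes_regular => //; exact: hs.
Qed.

(** The sides selected by [upper_angle] and [lower_angle] have their graph in []-1, 1[], which is
    the condition under which angles tend to [0] far out. *)
Lemma angle_vanishes (d : R) : 0 < d -> exists M, forall t, M <= `|t| -> `|angle e t| < d.
Proof.
move=> d0; have d2 : 0 < d / 2 by lra.
have /choice[g hg] : forall k, exists M, forall t, M <= `|t| ->
    -1 < graph e k t < 1 -> `|theta e k t| < d / 2.
  move=> k.
  have [M1 h1] := ang_pinfty (x1 (e k) / x2 (e k)) (x3 (e k) / x2 (e k)) (d / 2) d2.
  have [M2 h2] := ang_ninfty (x1 (e k) / x2 (e k)) (x3 (e k) / x2 (e k)) (d / 2) d2.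
  exists (Num.max M1 M2) => t; rewrite ge_max; case: (ger0P t) => t0 /andP[t1 t2] wt.
    exact: h1.
  by apply: h2 => //; lra.
exists (\big[Num.max/0]_k g k) => t Mt.
have gk k : g k <= `|t| by apply: le_trans Mt; exact: le_bigmax.
have hu : `|upper_angle e t| < d / 2.
  rewrite /upper_angle; case: pselect => [h|nh]; last by rewrite normr0.
  by case: (cid h) => k [uk wk]; exact: hg.
have hl : `|lower_angle e t| < d / 2.
  rewrite /lower_angle; case: pselect => [h|nh]; last by rewrite normr0.
  by case: (cid h) => k [uk wk]; exact: hg.
rewrite /angle; case: pselect => [U|nU]; last by rewrite normr0.
by apply: le_lt_trans (ler_normB _ _) _; lra.
Qed.

Hypothesis has_interior : exists x, H2 x /\ forall i, mink x (e i) < 0.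

Lemma inner_nonempty : exists t, inner e t.
Proof.
have [[[y1 y2] y3] [[/= yH y0] yi]] := has_interior.
move: yH y0; rewrite /mink /x1 /x2 /x3 /= => yH y0.
exists (y1 / hypot y2).
have r0 := hypot_gt0 y2.
have yE : (y1, y2, y3) = cyl (y1 / hypot y2) y2.
  rewrite -hlift_cyl mulrC divfK ?gt_eqF// /hlift /=; congr (_, _).
  rewrite -[LHS](ger0_norm (ltW y0)) -sqrtr_sqr; congr Num.sqrt.
  by lra.
have lev k : x2 (e k) * (y2 / hypot y2) < level e k (y1 / hypot y2).
  by have := yi k; rewrite yE mink_cyl pmulr_rlt0// subr_lt0.
have /andP[s1 s2] := tau_ltr1 y2.
have lo k : 0 < x2 (e k) -> y2 / hypot y2 < graph e k (y1 / hypot y2).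
  by move=> bk; have := lev k; rewrite levelE ?gt_eqF// ltr_pM2l.
have up k : x2 (e k) < 0 -> graph e k (y1 / hypot y2) < y2 / hypot y2.
  by move=> bk; have := lev k; rewrite levelE ?lt_eqF// ltr_nM2l.
split.
- by move=> k bk; have := lev k; rewrite bk mul0r.
- by move=> k bk; have := lo k bk; lra.
- by move=> k bk; have := up k bk; lra.
- by move=> k l bk bl; have := lo k bk; have := up l bl; lra.
Qed.

Lemma harea_ge_pihalf : ((pi / 2)%:E <= harea (hpoly e))%E.
Proof.
have [t0 Ut0] := inner_nonempty.
have pi2 : 0 < pi / 2 :> R by have := pi_gt0 R; lra.
apply/lee_subgt0Pr => d d0; rewrite -EFinB.
have [D0 HD0] := contributes_exists t0 (t0 + 1) ltac:(lra).
have D0p : 0 < D0 by case: HD0 => _ /(_ Ut0).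
(* The end angles will differ by less than [c]. Being at most [D0], [c] leaves the multiple of
   [pi/2] positive, hence at least [pi/2]; being at most [d], it costs no more than the
   tolerance. *)
pose c := Num.min d D0.
have c0 : 0 < c by rewrite lt_min d0.
have [M0 hM0] := angle_vanishes (c / 2) ltac:(lra).
pose M := Num.max M0 (`|t0| + 2).
have M1 : M0 <= M by rewrite le_max lexx.
have M2 : `|t0| + 2 <= M by rewrite le_max lexx orbT.
have tM : - M < t0 /\ t0 + 1 < M.
  by move: M2; case: (ger0P t0); lra.
have [D1 HD1] := contributes_exists (- M) t0 tM.1.
have [D2 HD2] := contributes_exists (t0 + 1) M tM.2.
have t01 : t0 < t0 + 1 by lra.
have HD01 := contributes_trans _ _ _ _ _ tM.1 t01 HD1 HD0.
have Mt : - M < t0 + 1 := lt_trans tM.1 t01.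
have [_ _ DI [k kE]] := contributes_trans _ _ _ _ _ Mt tM.2 HD01 HD2.
have D10 : 0 <= D1 by case: HD1.
have D20 : 0 <= D2 by case: HD2.
have M3 : 0 <= M by have : 0 <= `|t0| by []; lra.
have a1 : `|angle e M| < c / 2 by apply: hM0; rewrite ger0_norm.
have a2 : `|angle e (- M)| < c / 2 by apply: hM0; rewrite normrN ger0_norm.
move: a1 a2; rewrite !ltr_norml => /andP[a1 a1'] /andP[a2 a2'].
have cd : c <= d by rewrite ge_min lexx.
have cD : c <= D0 by rewrite ge_min lexx orbT.
have k0 : 0 < k%:~R * (pi / 2) :> R by rewrite -kE; lra.
have k1 : 1 <= k.
  by move: k0; rewrite pmulr_lgt0// ltr0z gtz0_ge1.
have k2 : pi / 2 <= k%:~R * (pi / 2) :> R.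
  by rewrite ler_peMl ?(ltW pi2)// ler1z.
apply: (@le_trans _ _ (D1 + D0 + D2)%:E); first by rewrite lee_fin; lra.
apply: le_trans DI _; rewrite harea_width; apply: ge0_subset_integral => //.
- exact: measurable_width.
- by move=> t _; exact: width_ge0.
Qed.

End pieces.

(** * The triangle [P2] *)

Section P2.
Context {R : realType}.
Local Notation mu := (@lebesgue_measure R).

Definition P2_normals (i : 'I_3) : pt R :=
  nth (0, 0, 0) [:: (-1, 0, 0); (0, -1, 0); (1, 1, 1)] i.

Lemma forall_I3 (P : 'I_3 -> Prop) :
  P (inord 0) -> P (inord 1) -> P (inord 2) -> forall i, P i.
Proof.
move=> P0 P1 Q2 [[|[|[|//]]] i3].
- by rewrite (_ : Ordinal i3 = inord 0)//; apply/val_inj; rewrite /= inordK.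
- by rewrite (_ : Ordinal i3 = inord 1)//; apply/val_inj; rewrite /= inordK.
- by rewrite (_ : Ordinal i3 = inord 2)//; apply/val_inj; rewrite /= inordK.
Qed.

Lemma P2_normals0 : P2_normals (inord 0) = (-1, 0, 0).
Proof. by rewrite /P2_normals inordK. Qed.

Lemma P2_normals1 : P2_normals (inord 1) = (0, -1, 0).
Proof. by rewrite /P2_normals inordK. Qed.

Lemma P2_normals2 : P2_normals (inord 2) = (1, 1, 1).
Proof. by rewrite /P2_normals inordK. Qed.

Definition P2_normalsE := (P2_normals0, P2_normals1, P2_normals2).

Lemma P2E : @P2 R = hpoly P2_normals.
Proof.
apply/seteqP; split => -[[a b] c] [hH].
  move=> [h1 h2 h3]; split=> //.
  move: h1 h2 h3; rewrite /x1 /x2 /x3 /= => h1 h2 h3.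
  by apply: forall_I3; rewrite P2_normalsE /mink /x1 /x2 /x3 /=; lra.
move=> h; split=> //.
have := h (inord 0); have := h (inord 1); have := h (inord 2).
by rewrite !P2_normalsE /mink /x1 /x2 /x3 /= => h2 h1 h0; split; lra.
Qed.

Lemma P2_spacelike i : 0 < mink (P2_normals i) (P2_normals i).
Proof.
by move: i; apply: forall_I3; rewrite P2_normalsE /mink /x1 /x2 /x3 /=; lra.
Qed.

Lemma P2_side i (a b c : R) :
  P2 (a, b, c) -> mink (a, b, c) (P2_normals i) = 0 -> hside P2_normals i (a, b, c).
Proof. by rewrite P2E. Qed.

Lemma right_angled_P2 : right_angled_polygon (@P2 R).
Proof.
exists 3, P2_normals; split.
- exact: P2E.
- exact: P2_spacelike.
(* This is [cyl (5 / 12) (5 / 12)]; since [hypot (5 / 12) = 13 / 12], its coordinates are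
   rational. *)
- exists (65 / 144, 5 / 12, 169 / 144); split.
    by split; rewrite /mink /x1 /x2 /x3 /=; lra.
  by apply: forall_I3; rewrite P2_normalsE /mink /x1 /x2 /x3 /=; lra.
- apply: forall_I3.
  + exists (0, 0, 1), (0, 5 / 12, 13 / 12).
    by split; [apply: P2_side; rewrite ?P2_normalsE; last (by rewrite /mink /x1 /x2 /x3 /=; lra);
     split; [split | split]; rewrite /mink /x1 /x2 /x3 /=; lra ..|
     case; lra].
  + exists (0, 0, 1), (5 / 12, 0, 13 / 12).
    by split; [apply: P2_side; rewrite ?P2_normalsE; last (by rewrite /mink /x1 /x2 /x3 /=; lra);
     split; [split | split]; rewrite /mink /x1 /x2 /x3 /=; lra ..|
     case; lra].
  + exists (1, 1 / 2, 3 / 2), (1 / 2, 1, 3 / 2).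
    by split; [apply: P2_side; rewrite ?P2_normalsE; last (by rewrite /mink /x1 /x2 /x3 /=; lra);
     split; [split | split]; rewrite /mink /x1 /x2 /x3 /=; lra ..|
     case; lra].
- have sym (x y : pt R) : mink x y = mink y x.
    by rewrite /mink; ring.
  have h01 : mink (P2_normals (inord 0)) (P2_normals (inord 1)) = 0.
    by rewrite !P2_normalsE /mink /x1 /x2 /x3 /=; lra.
  (* A common point would have [x1 = 0] and [x2 = x3], hence norm [0] instead of [-1]: these two
     sides meet only at an ideal point. *)
  have h02 x : hside P2_normals (inord 0) x -> hside P2_normals (inord 2) x -> False.
    case: x => [[a b] c] [[[+ _] _] +] [_]; rewrite !P2_normalsE /mink /x1 /x2 /x3 /=.
    move=> h1 h2 h3; have a0 : a = 0 by lra.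
    have bc : b = c by lra.
    by move: h1; rewrite a0 bc; lra.
  have h12 x : hside P2_normals (inord 1) x -> hside P2_normals (inord 2) x -> False.
    case: x => [[a b] c] [[[+ _] _] +] [_]; rewrite !P2_normalsE /mink /x1 /x2 /x3 /=.
    move=> h1 h2 h3; have b0 : b = 0 by lra.
    have bc : a = c by lra.
    by move: h1; rewrite b0 bc; lra.
  apply: forall_I3; apply: forall_I3 => // _ [x [/= hx hy]].
  + by have := h02 x hx hy.
  + by rewrite sym.
  + by have := h12 x hx hy.
  + by have := h02 x hy hx.
  + by have := h12 x hy hx.
Qed.

Lemma slope11 (t : R) : 0 < t -> 0 < slope 1 1 t < 1.
Proof.
move=> t0; have r0 := hypot_gt0 t; have r2 := sqr_hypot t.
rewrite /slope !mul1r subr_gt0; apply/andP; split; nra.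
Qed.

Lemma width_P2_neg (t : R) : t < 0 -> width P2_normals t = 0%E.
Proof.
move=> t0; rewrite /width (_ : [set s | _] = set0) ?measure0 ?mule0//.
apply/seteqP; split => // s /= /hpoly_cyl /(_ (inord 0)).
by rewrite /level P2_normalsE /slope /x1 /x2 /x3 /=; lra.
Qed.

Lemma width_P2_pos (t : R) : 0 < t ->
  width P2_normals t = (sigma (slope 1 1 t) / hypot t)%:E.
Proof.
move=> t0; have /andP[w0 w1] := slope11 t t0.
have ww : -1 < slope 1 1 t < 1 by lra.
have s00 : slope 0 0 t = 0 by rewrite /slope !mul0r subr0.
have s0 : 0 < sigma (slope 1 1 t).
  by rewrite divr_gt0// sqrtr_gt0; nra.
rewrite /width (_ : [set s | _] = `[0, sigma (slope 1 1 t)]%classic).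
  by rewrite lebesgue_measure_itv/= lte_fin s0 sube0 -EFinM mulrC.
apply/seteqP; split => s /=; rewrite in_itv/=.
  move=> /hpoly_cyl h; have := h (inord 1); have := h (inord 2).
  rewrite /level !P2_normalsE /x1 /x2 /x3 /= mul1r tau_le// => ->.
  rewrite s00 mulN1r oppr_le0 andbT.
  by rewrite pmulr_lge0// invr_gt0 hypot_gt0.
move=> /andP[s1 s2]; apply/hpoly_cyl; apply: forall_I3;
  rewrite /level P2_normalsE /x1 /x2 /x3 /=.
- by rewrite /slope; lra.
- rewrite s00 mulN1r oppr_le0.
  by rewrite divr_ge0// ltW// hypot_gt0.
- by rewrite mul1r tau_le.
Qed.

Lemma casin_le0 (x : R) : x <= 0 -> casin x <= 0.
Proof.
move=> x0; rewrite leNgt; apply/negP => c0.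
have /andP[h1 h2] := casin_itv x.
have : 0 < sin (casin x).
  by apply: sin_gt0_pi; have := pi_gt0 R => ?; apply/andP; lra.
rewrite asinK ?in_itv/= ?clip_itv//.
by rewrite /clip; case: (ger0P (x + 1)); case: (ger0P (x - 1)); lra.
Qed.

(** For [t > 0] the primitive is [ang 1 1 t], the arcsine of [t - hypot t], which rises from
    [- pi/2] at [0] towards [0] at infinity. On the segments of [F] its increment is bounded using
    only that it is at least [- pi/2] on the left and at most [0] on the right. *)
Lemma harea_P2 : (harea (@P2 R) <= (pi / 2)%:E)%E.
Proof.
rewrite P2E harea_width.
have mw D : measurable D -> measurable_fun D (width P2_normals).
  by move=> mD; exact: measurable_funS (measurable_width P2_normals).
have w0 t := width_ge0 P2_normals t.
have -> : [set: R] = `]-oo, 0[%classic `|` `[0, +oo[%classic.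
  by apply/seteqP; split => // t _ /=; rewrite !in_itv/= andbT; case: (ltP t 0); [left|right].
rewrite ge0_integral_setU//=; last 2 first.
- by apply: mw; exact: measurableU.
- by apply/disj_setPS => t /= []; rewrite !in_itv/= andbT; lra.
rewrite integral0_eq ?add0e; last first.
  by move=> t /=; rewrite in_itv/= => /width_P2_neg.
rewrite -integral_itv_obnd_cbnd; last exact: mw.
pose F (m : nat) : set R := `[m.+1%:R^-1, m.+1%:R]%classic.
have FE : `]0, +oo[%classic = \bigcup_m F m.
  apply/seteqP; split => t /=; rewrite in_itv/= andbT.
    move=> t0; pose N := Num.bound (t + t^-1).
    exists N => //; rewrite /F /= in_itv/=.
    have tN : t + t^-1 < N.+1%:R.
      apply: lt_trans (archi_boundP _) _; first by rewrite addr_ge0// ?invr_ge0 ltW.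
      by rewrite ltr_nat.
    have ti : 0 < t^-1 by rewrite invr_gt0.
    rewrite -[t in X in X && _]invrK lef_pV2 ?posrE//; apply/andP; lra.
  move=> [m _] /=; rewrite /F /= in_itv/= => /andP[+ _].
  by apply: lt_le_trans; rewrite invr_gt0.
rewrite FE.
have ndF : nondecreasing_seq F.
  move=> m k mk; apply/subsetPset => t; rewrite /F /= !in_itv/= => /andP[h1 h2].
  apply/andP; split.
    by apply: le_trans h1; rewrite lef_pV2 ?posrE// ler_nat ltnS.
  by apply: le_trans h2 _; rewrite ler_nat ltnS.
have cv : (\int[mu]_(x in F m) width P2_normals x @[m --> \oo] -->
    \int[mu]_(x in \bigcup_m F m) width P2_normals x)%E.
  apply: ge0_nondecreasing_set_cvg_integral => // m.
    exact: measurable_itv.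
  by apply: mw; exact: measurable_itv.
rewrite -(cvg_lim _ cv)//; apply: lime_le; first by apply/cvg_ex; eexists; exact: cv.
near=> m.
have m1 : (1 < m)%N by near: m; exact: nbhs_infty_gt.
have m2 : m.+1%:R^-1 < m.+1%:R :> R.
  by apply: (@lt_trans _ _ 1); rewrite ?invf_lt1 ?ltr1n// ltnS ltnW.
have m0 : 0 < m.+1%:R^-1 :> R by rewrite invr_gt0.
pose h t : R := sigma (slope 1 1 t) / hypot t.
have -> : (\int[mu]_(x in F m) width P2_normals x = \int[mu]_(x in F m) (h x)%:E)%E.
  apply: eq_integral => t; rewrite inE /F /= in_itv/= => /andP[t1 t2].
  by rewrite width_P2_pos//; exact: lt_le_trans t1.
have dG (t : R) : m.+1%:R^-1 <= t <= m.+1%:R -> is_derive t (1 : R) (ang 1 1) (h t).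
  move=> /andP[t1 t2]; have /andP[h1 h2] := slope11 t (lt_le_trans m0 t1).
  by apply: is_derive_ang; lra.
rewrite (integral_antiderivative (ang 1 1) h _ _ m2 dG).
  rewrite lee_fin.
  have /andP[a1 _] : - (pi / 2) <= ang 1 1 (m.+1%:R^-1 : R) <= pi / 2.
    exact: casin_itv.
  have a2 : ang 1 1 (m.+1%:R : R) <= 0.
    apply: casin_le0; rewrite addrK sqrtr1 divr1 -opprB oppr_le0.
    by have /andP[] := slope11 (m.+1%:R : R) (ltr0Sn _ _); rewrite /slope; lra.
  lra.
move=> t /andP[t1 t2]; have /andP[h1 h2] := slope11 t (lt_le_trans m0 t1).
have hh : hypot u @[u --> t] --> hypot t by exact: continuous_hypot.
apply: cvgM; last by apply: (cvgV _ hh); rewrite gt_eqF ?hypot_gt0.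
apply: continuous_comp; first exact: continuous_slope.
by apply: continuous_sigma; lra.
Unshelve. all: by end_near. Qed.

End P2.

Theorem theorem3p2 (R : realType) :
  [/\ right_angled_polygon (@P2 R),
      (harea (@P2 R) < +oo)%E
    & forall S : set (pt R), right_angled_polygon S -> (harea S < +oo)%E ->
        (harea (@P2 R) <= harea S)%E].
Proof.
split.
- exact: right_angled_P2.
- exact: le_lt_trans harea_P2 (ltry _).
- move=> _ [n [e [-> sp int _ orth]]] _.
  exact: le_trans harea_P2 (harea_ge_pihalf e sp orth int).
Qed.
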